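(* Let $G$ be a connected graph of order $n \ge 7$. If $\mu_2(G) \ge n$, then $G$ has two completely independent spanning trees.
   Context: All graphs are undirected, finite and simple. The order of $G$ is $n = |V(G)|$; $d(v)$ denotes the degree of a vertex $v$ in $G$, and $d(u,v)$ the distance between vertices $u$ and $v$ in $G$. If $G$ is not a complete graph, $\mu_2(G) = \min\{d(u)+d(v) : u,v \in V(G),\ d(u,v)=2\}$; if $G$ is complete, $\mu_2(G)=+\infty$. A spanning tree of $G$ is a subgraph of $G$ that is a tree with vertex set $V(G)$. Spanning trees $T_1,\dots,T_k$ of $G$ are $k$ completely independent spanning trees if, for any two vertices $u,v$ of $G$, the paths from $u$ to $v$ in $T_1,\dots,T_k$ are pairwise edge-disjoint and internally vertex-disjoint (no two of them share an edge or a vertex other than $u$ and $v$). *)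

(* Defs.v *)
From mathcomp Require Import all_boot.

Set Implicit Arguments.
Unset Strict Implicit.
Unset Printing Implicit Defensive.

(* A graph with vertex type T is given by its adjacency relation. *)

(* Naturals extended with +oo, which is encoded as None. *)
Definition natbar := option nat.

Definition min_natbar (a b : natbar) : natbar :=
  match a, b with
  | Some m, Some n => Some (minn m n)
  | Some m, None => Some m
  | None, _ => b
  end.

Definition le_natbar (a b : natbar) : bool :=
  match a, b with
  | _, None => true
  | None, Some _ => false
  | Some m, Some n => m <= n
  end.

Section Graphs.
Variable T : finType.
Implicit Types (e t : rel T) (u v w : T) (p q : seq T).

Definition simple_graph e : Prop := symmetric e /\ irreflexive e.

Definition connected_graph e : Prop := forall u v, connect e u v.

Definition complete_graph e : bool := [forall u, forall v, (u != v) ==> e u v].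

Definition degree e v : nat := #|[set w | e v w]|.

Definition walk_of_length e u v (k : nat) : bool :=
  [exists p : k.-tuple T, path e u p && (last u p == v)].

(* A shortest walk repeats no vertex, so only lengths below #|T| have to be
   searched; find returns #|T| when v is not reachable from u. *)
Definition distance e u v : natbar :=
  let k := find (walk_of_length e u v) (iota 0 #|T|) in
  if k < #|T| then Some k else None.

Definition mu2 e : natbar :=
  if complete_graph e then None
  else \big[min_natbar/None]_(x : T * T | distance e x.1 x.2 == Some 2)
         Some (degree e x.1 + degree e x.2).

(* Quantifying over lists of at least three distinct vertices excludes the
   degenerate cycles u-v-u. *)
Definition acyclic_graph e : Prop :=
  forall c : seq T, 2 < size c -> uniq c -> ~~ cycle e c.

Definition tree e : Prop :=
  [/\ simple_graph e, connected_graph e & acyclic_graph e].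

(* The vertex set of t is the whole type T, so t spans by construction. *)
Definition spanning_tree e t : Prop := subrel t e /\ tree t.

(* The vertices of the path are those of u :: p, without repetition. *)
Definition path_between e u v p : bool :=
  [&& path e u p, uniq (u :: p) & last u p == v].

Definition path_edges u p : seq {set T} :=
  pairmap (fun x y => [set x; y]) u p.

Definition edge_disjoint u p q : Prop :=
  forall d, ~~ ((d \in path_edges u p) && (d \in path_edges u q)).

Definition internally_disjoint u v p q : Prop :=
  forall w, w \in u :: p -> w \in u :: q -> w = u \/ w = v.

Definition completely_independent k (t : 'I_k -> rel T) : Prop :=
  forall (u v : T) (i j : 'I_k) (p q : seq T), u != v -> i != j ->
    path_between (t i) u v p -> path_between (t j) u v q ->
    edge_disjoint u p q /\ internally_disjoint u v p q.

Definition has_completely_independent_spanning_trees k e : Prop :=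
  exists t : 'I_k -> rel T,
    (forall i, spanning_tree e (t i)) /\ completely_independent t.

End Graphs.

(* Main.v *)
Require Import Defs.
From mathcomp Require Import all_boot.
From mathcomp Require Import zify.

Set Implicit Arguments.
Unset Strict Implicit.
Unset Printing Implicit Defensive.

(** Two completely independent spanning trees come from a partition of the
    vertices into A and its complement B, both inducing connected subgraphs,
    together with a map f sending every vertex to a neighbour on the other side
    and satisfying f (f v) != v: join a spanning tree of A to the edges v -- f v
    with v in B, and symmetrically. Such an f exists as soon as the bipartite
    graph of the edges between A and B remains connected after deleting one of
    its edges.

    Let x be a vertex of maximum degree. Then every vertex is at distance at
    most 2 from x; let N be the neighbourhood of x and call the vertices outside
    N and x far. Take A = {x} + S for a set S of neighbours of x that dominates
    the far vertices. The degree condition says that two nonadjacent vertices u,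
    v at distance 2 have at least as many common neighbours as there are vertices
    adjacent to neither; this makes B connected when S is minimal. If S is of
    minimum size, with at least two elements, it can be chosen such that every
    vertex of S has a neighbour in N - S, and then A works unless the bipartite
    graph is a tree, in which case adding one more vertex of N to S, or replacing
    S by N - S, does. If a single neighbour of x dominates the far vertices, one
    or two well chosen neighbours of x form S, except for a balanced complete
    bipartite graph. *)

(** * Spanning trees from a partition *)

Section Trees.
Variable T : finType.
Implicit Types (h t : rel T) (r u v w : T) (par : T -> T) (rk : T -> nat).

(** Breadth-first search: [rk] is the length of a shortest walk from [r], and the last but one
    vertex of such a walk is a neighbour of smaller rank. *)
Lemma parent_function h r : (forall v, connect h r v) ->
  exists par rk, forall v, v != r -> h (par v) v /\ rk (par v) < rk v.
Proof.
move=> hr.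
have walkE v : exists k, walk_of_length h r v k.
  have /connectP[p hp ->] := hr v.
  by exists (size p); apply/existsP; exists (in_tuple p); rewrite hp eqxx.
pose rk v := ex_minn (walkE v).
have rkP v : v != r -> exists u, h u v && (rk u < rk v).
  move=> vr; rewrite {2}/rk; case: ex_minnP => k /existsP[p /andP[hp /eqP pv]] _.
  have : size p = k by rewrite size_tuple.
  case/lastP: (val p) hp pv => [_ /= rv|q z]; first by rewrite -rv eqxx in vr.
  rewrite rcons_path last_rcons size_rcons => /andP[hq hz] <- <-.
  exists (last r q); rewrite hz /=.
  rewrite ltnS /rk; case: ex_minnP => m _; apply.
  by apply/existsP; exists (in_tuple q); rewrite hq eqxx.
exists (fun v => odflt r [pick u | h u v && (rk u < rk v)]), rk => v vr.
case: pickP => [u /andP[] //|none]; have [u hu] := rkP v vr.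
by rewrite none in hu.
Qed.

Definition parent_rel r par : rel T :=
  [rel u v | (u != r) && (par u == v) || (v != r) && (par v == u)].

Lemma parent_tree r par rk :
  (forall v, v != r -> rk (par v) < rk v) -> tree (parent_rel r par).
Proof.
move=> rkP.
have symt : symmetric (parent_rel r par) by move=> u v; rewrite /parent_rel /= orbC.
split; first split=> // u.
- by apply/negbTE/negP; rewrite /parent_rel /= orbb => /andP[/rkP + /eqP ur]; rewrite ur ltnn.
- have toroot v : connect (parent_rel r par) v r.
    have [n] := ubnP (rk v); elim: n v => // n IH v; rewrite ltnS => le_n.
    have [->|vr] := eqVneq v r; first exact: connect0.
    apply: connect_trans (IH (par v) (leq_trans (rkP v vr) le_n)).
    by apply: connect1; rewrite /parent_rel /= vr eqxx.
  move=> u v; apply: connect_trans (toroot u) _.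
  by rewrite (sym_connect_sym symt).
- move=> c c3 uc; apply/negP => cyc.
  (* Both neighbours on the cycle of a vertex of largest rank are its parent. *)
  have [v vc vmax] : exists2 v, v \in c & forall u, u \in c -> rk u <= rk v.
    case: c c3 {uc cyc} => // z c _.
    elim: c z => [|y c IH] z; first by exists z => [|u]; rewrite inE // => /eqP->.
    have [v vc vm] := IH y.
    have [le|lt] := leqP (rk z) (rk v).
      exists v; first by rewrite inE vc orbT.
      by move=> u; rewrite inE => /predU1P[->|/vm].
    exists z => [|u]; first by rewrite inE eqxx.
    by rewrite inE => /predU1P[->//|/vm /leq_trans]; apply; apply: ltnW.
  have parv u : u \in c -> parent_rel r par v u -> u = par v.
    move=> uc' /orP[/andP[_ /eqP]//|/andP[/rkP lt /eqP uv]].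
    by move: lt; rewrite uv ltnNge vmax.
  have [i c' ci] := rot_to vc.
  have {}cyc : cycle (parent_rel r par) (v :: c') by rewrite -ci rot_cycle.
  have {}uc : uniq (v :: c') by rewrite -ci rot_uniq.
  have memc u : u \in c' -> u \in c.
    by move=> uc'; rewrite -(mem_rot i) ci inE uc' orbT.
  have : size (v :: c') = size c by rewrite -ci size_rot.
  case: c' cyc uc memc {ci} => [|a [|b c']] /=.
  + by move=> _ _ _ sz; rewrite -sz in c3.
  + by move=> _ _ _ sz; rewrite -sz in c3.
  rewrite rcons_path => /and3P[va ab /andP[bc lv]] uc memc _.
  have aE : a = par v by apply: parv => //; apply: memc; rewrite inE eqxx.
  have lE : last b c' = par v.
    apply: parv; last by rewrite symt.
    by apply: memc; rewrite inE mem_last orbT.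
  move: uc; rewrite !inE => /and3P[_ + _].
  by rewrite aE -lE -in_cons mem_last.
Qed.
End Trees.

(** * Partitions that yield two completely independent spanning trees *)

Section Partition.
Variables (T : finType) (e : rel T).
Hypothesis e_simple : simple_graph e.
Implicit Types (A B : {set T}) (t : rel T) (u v w : T) (p : seq T).

Let e_sym : symmetric e := proj1 e_simple.
Let e_irr : irreflexive e := proj2 e_simple.

Definition induced A : rel T := [rel u v | [&& u \in A, v \in A & e u v]].

Definition connected_in A : Prop := {in A &, forall u v, connect (induced A) u v}.

(** When [f] maps the complement of [A] into [A], a vertex outside [A] has no neighbour in [t] but
    its image under [f], so it is a leaf. *)
Definition leaves_outside A (f : T -> T) t : Prop :=
  forall u v, t u v ->
    [|| (u \in A) && (v \in A), (u \notin A) && (v == f u)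
      | (v \notin A) && (u == f v)].

Lemma half_tree A (f : T -> T) :
    A != set0 -> connected_in A -> (forall v, e v (f v)) ->
    (forall v, v \notin A -> f v \in A) ->
  exists t, spanning_tree e t /\ leaves_outside A f t.
Proof.
move=> /set0Pn[r rA] cA ef fA.
(* The outer edges are directed from [f v] to [v], so that a search starting in [A] reaches the
   vertices outside [A] only as leaves. *)
pose h := [rel u v | induced A u v || [&& v \notin A & u == f v]].
have subh : {subset A <= connect h r}.
  move=> v vA; have := cA r v rA vA; apply: connect_sub => x y xy.
  by apply: connect1; rewrite /= xy.
have hr v : connect h r v.
  have [/subh//|vA] := boolP (v \in A).
  apply: connect_trans (subh _ (fA v vA)) _.
  by apply: connect1; rewrite /= vA eqxx orbT.
have [par [rk parP]] := parent_function hr.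
exists (parent_rel r par); split.
- split; last by apply: (@parent_tree _ r par rk) => v /parP[].
  have sub v : v != r -> e (par v) v.
    by case/parP=> /orP[/and3P[] //|/andP[_ /eqP->]] _; rewrite e_sym.
  by move=> u v /orP[] /andP[/sub euv /eqP<-]; rewrite // e_sym.
- by move=> u v /orP[] /andP[/parP[+ _] /eqP pu]; rewrite /= pu;
    case/orP=> [/and3P[-> -> _]|/andP[-> /eqP->]]; rewrite ?eqxx ?orbT.
Qed.

(** An interior vertex of a path has two different neighbours in [t], whereas a vertex outside [A]
    has only one. *)
Lemma internal_mem A f t u p w : leaves_outside A f t ->
    (forall v, v \notin A -> f v \in A) -> symmetric t ->
    path t u p -> uniq (u :: p) -> w \in u :: p -> w != u -> w != last u p ->
  w \in A.
Proof.
move=> lt fA tsym tp up wp wu wl; apply/negPn/negP => wA.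
have leaf z : t w z -> z = f w.
  move=> /lt; rewrite (negbTE wA) /= => /orP[/eqP//|/andP[zA /eqP wz]].
  by rewrite wz fA in wA.
move: wp; rewrite inE (negbTE wu) /= => wp.
case/splitPr: wp tp up wl => p1 [|z p2]; first by rewrite last_cat /= eqxx.
rewrite cat_path -cat_cons cat_uniq => /and3P[_ uw /andP[wz _]] /and3P[_ nin _] _.
case/negP: nin; apply/hasP; exists (last u p1); last exact: mem_last.
by rewrite tsym in uw; rewrite (leaf _ uw) -(leaf z wz) !inE eqxx orbT.
Qed.

Lemma path_edgesP t u p d : path t u p -> d \in path_edges u p ->
  exists a b, t a b /\ d = [set a; b].
Proof.
elim: p u => //= z p IH u /andP[tuz tp]; rewrite inE => /predU1P[->|].
  by exists u, z.
exact: IH.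
Qed.

(** Interior vertices of paths lie in [A] for the first tree and outside [A] for the second, so they
    cannot meet. An edge common to both trees would join some [v] to [f v] with [f (f v) = v]. *)
Lemma cist_of_partition A (f : T -> T) :
    A != set0 -> ~: A != set0 -> connected_in A -> connected_in (~: A) ->
    (forall v, e v (f v)) -> (forall v, (f v \in A) = (v \notin A)) ->
    (forall v, f (f v) != v) ->
  has_completely_independent_spanning_trees 2 e.
Proof.
move=> A0 A1 cA cB ef fA ff.
have fA1 v : v \notin A -> f v \in A by rewrite fA.
have fB1 v : v \notin ~: A -> f v \in ~: A by rewrite !inE fA.
have [t [st lt]] := half_tree A0 cA ef fA1.
have [t' [st' lt']] := half_tree A1 cB ef fB1.
have tsym : symmetric t by case: st => _ [[]].
have tsym' : symmetric t' by case: st' => _ [[]].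
have tt' a b : t a b -> t' a b -> False.
  move=> /lt + /lt'; rewrite !inE !negbK.
  have nf c d : (c \in A) = (d \in A) -> c == f d = false.
    by move=> E; apply/eqP => cE; move: E; rewrite cE fA; case: (_ \in A).
  case: (boolP (a \in A)) => aA; case: (boolP (b \in A)) => bA //=.
  - by rewrite !nf ?aA ?bA.
  - by move=> /eqP abE; rewrite orbF => /eqP ba; move: (ff b); rewrite -abE -ba eqxx.
  - by rewrite orbF => /eqP abE /eqP ba; move: (ff a); rewrite -abE -ba eqxx.
  - by rewrite !nf ?(negbTE aA) ?(negbTE bA).
have disj u v p q : u != v -> path_between t u v p -> path_between t' u v q ->
    edge_disjoint u p q /\ internally_disjoint u v p q.
  move=> uv /and3P[tp up /eqP pv] /and3P[tq uq /eqP qv]; split.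
    move=> d; apply/negP => /andP[/(path_edgesP tp)[a [b [tab ->]]]].
    move=> /(path_edgesP tq)[a' [b' [tab' E]]].
    have aE : a \in [set a'; b'] by rewrite -E !inE eqxx.
    have bE : b \in [set a'; b'] by rewrite -E !inE eqxx orbT.
    have ab : a != b.
      by case: st => _ [[_ it] _ _]; apply/eqP => ab; rewrite ab it in tab.
    apply: (tt' a b tab).
    move: aE bE ab; rewrite !inE => /pred2P[] -> /pred2P[] ->; rewrite ?eqxx //.
    by rewrite tsym'.
  move=> w wp wq; have [->|wu] := eqVneq w u; first by left.
  have [->|wv] := eqVneq w v; first by right.
  have wA : w \in A by apply: (internal_mem lt fA1 tsym tp up wp wu); rewrite pv.
  have : w \in ~: A by apply: (internal_mem lt' fB1 tsym' tq uq wq wu); rewrite qv.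
  by rewrite inE wA.
exists (fun i : 'I_2 => if i == ord0 then t else t'); split.
  by move=> i; case: ifP.
move=> u v i j p q uv ij.
case: ifP => i0; case: ifP => j0 pu qu.
- by rewrite (eqP i0) (eqP j0) eqxx in ij.
- exact: disj.
- have [ed id] := disj u v q p uv qu pu.
  split=> [d|w wp wq]; first by rewrite andbC.
  exact: id.
- by move: i j i0 j0 ij {pu qu} => [[|[|i]] hi] [[|[|j]] hj].
Qed.

Definition cross_minus A u v : rel T :=
  [rel a b | [&& e a b, (a \in A) != (b \in A)
             & ~~ ((a == u) && (b == v) || (a == v) && (b == u))]].

Lemma cross_minus_sym A u v : symmetric (cross_minus A u v).
Proof.
move=> a b; rewrite /cross_minus /= e_sym (eq_sym (a \in A)).
by rewrite (andbC (a == u)) (andbC (a == v)) orbC.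
Qed.

(* Orient a spanning tree of the cross graph without the edge u v towards u,
   and u along u v. *)
Lemma cist_of_cross A x u v :
    connected_in A -> connected_in (~: A) ->
    u \in A -> v \notin A -> e u v ->
    (forall z, connect (cross_minus A u v) x z) ->
  has_completely_independent_spanning_trees 2 e.
Proof.
move=> cA cB uA vA euv cx.
have cu z : connect (cross_minus A u v) u z.
  apply: connect_trans (cx z).
  by rewrite (sym_connect_sym (@cross_minus_sym A u v)).
have [par [rk parP]] := parent_function cu.
pose f z := if z == u then v else par z.
have fE z : e z (f z) /\ (f z \in A) = (z \notin A).
  rewrite /f; have [->|zu] := eqVneq z u; first by rewrite uA (negbTE vA).
  have [/and3P[ez Az _] _] := parP z zu; rewrite e_sym ez; split=> //.
  by move: Az; do 2!case: (_ \in A).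
apply: (@cist_of_partition A f) => //; try by move=> z; case: (fE z).
- by apply/set0Pn; exists u.
- by apply/set0Pn; exists v; rewrite inE.
(* Coming back to [z] after two steps would use the deleted edge if [u] is involved, and would
   contradict the decrease of the rank otherwise. *)
move=> z; rewrite /f; have [->|zu] := eqVneq z u.
  have vu : v != u by apply: contraNneq vA => ->.
  rewrite (negbTE vu); apply/eqP => pv.
  by have [/and3P[_ _]] := parP v vu; rewrite pv !eqxx.
have [hz lt] := parP z zu.
have [pu|pu] := eqVneq (par z) u.
  by apply: contraTneq hz => vz; rewrite /cross_minus /= pu vz !eqxx !andbF.
have [_ lt'] := parP _ pu; apply/eqP => pz.
by move: (ltn_trans lt' lt); rewrite pz ltnn.
Qed.
End Partition.

(** * Partitions whose first part is a star *)

Section Star.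
Variables (T : finType) (e : rel T).
Hypothesis e_simple : simple_graph e.
Implicit Types (A S : {set T}) (u v w x : T).

Let e_sym : symmetric e := proj1 e_simple.
Let e_irr : irreflexive e := proj2 e_simple.
Local Notation nb v := [set w | e v w].

Lemma induced_sym A : symmetric (induced e A).
Proof. by move=> u v; rewrite /induced /= e_sym andbCA. Qed.

Lemma connect_induced_sym A u v :
  connect (induced e A) u v = connect (induced e A) v u.
Proof. exact/sym_connect_sym/induced_sym. Qed.

Lemma star_connected x S : S \subset nb x -> connected_in e (x |: S).
Proof.
move=> /subsetP Sx.
have cx v : v \in x |: S -> connect (induced e (x |: S)) x v.
  move=> /setU1P[->|vS]; first exact: connect0.
  apply: connect1; rewrite /induced /= !in_setU1 eqxx vS orbT /=.
  by have := Sx v vS; rewrite inE.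
move=> u v uS vS; apply: connect_trans (cx v vS).
by rewrite connect_induced_sym; apply: cx.
Qed.

Lemma cross_minus_edge A u v a b : u \in A -> v \notin A ->
    e a b -> a \in A -> b \notin A -> (a != u) || (b != v) ->
  cross_minus e A u v a b.
Proof.
move=> uA vA eab aA bA ne; rewrite /cross_minus /= eab aA (negbTE bA) /=.
rewrite negb_or !negb_and ne /=.
by apply/orP; left; apply: contraNneq vA => <-.
Qed.

(** The neighbours of [x] outside [S] are joined to [x] by cross edges that are not deleted, so only
    [S] and the far vertices remain to be reached. *)
Lemma cist_star x S u v :
    S \subset nb x -> connected_in e (~: (x |: S)) ->
    u \in S -> v \notin x |: S -> e u v ->
    (forall s, s \in S -> connect (cross_minus e (x |: S) u v) x s) ->
    (forall w, w \notin x |: nb x ->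
       exists2 s, s \in S & cross_minus e (x |: S) u v s w) ->
  has_completely_independent_spanning_trees 2 e.
Proof.
move=> Sx cB uS vA euv cS cW.
have uA : u \in x |: S by rewrite in_setU1 uS orbT.
have xu : x != u.
  by apply/eqP => xu; have := subsetP Sx u uS; rewrite inE xu e_irr.
apply: (cist_of_cross e_simple (star_connected Sx) cB uA vA euv (x := x)) => z.
have [/cW[s sS sz]|] := boolP (z \notin x |: nb x).
  exact: connect_trans (cS s sS) (connect1 sz).
rewrite negbK in_setU1 inE => /predU1P[->|xz]; first exact: connect0.
have [/cS//|zS] := boolP (z \in S).
apply: connect1; apply: cross_minus_edge => //; rewrite ?xu // in_setU1 ?eqxx //.
by rewrite negb_or zS andbT; apply: contraTneq xz => ->; rewrite e_irr.
Qed.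

Lemma notin_star x S p : p \in nb x :\: S -> p \notin x |: S.
Proof.
rewrite in_setD in_setU1 inE => /andP[pS xp]; rewrite negb_or pS andbT.
by apply: contraTneq xp => ->; rewrite e_irr.
Qed.

Lemma far_notin_star x S w : S \subset nb x ->
  w \notin x |: nb x -> w \notin x |: S.
Proof.
move=> Sx; apply: contra; rewrite !in_setU1 => /orP[->//|/(subsetP Sx) ->].
by rewrite orbT.
Qed.

(** Cross paths from [x] through N - S to [S] and on to the far vertices reach everything. The two
    forms of [extra] supply an edge that can be deleted: without [s p2], the vertex [s] is still
    reached through [p1]; without [s2 w], the vertex [w] is still reached through [s1]. *)
Lemma cist_dominating x S :
    S \subset nb x -> connected_in e (~: (x |: S)) ->
    (forall w, w \notin x |: nb x -> exists2 s, s \in S & e s w) ->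
    (forall s, s \in S -> exists2 p, p \in nb x :\: S & e s p) ->
    (exists s p1 p2, [/\ s \in S, p1 \in nb x :\: S & p2 \in nb x :\: S] /\
       [/\ e s p1, e s p2 & p1 != p2]) \/
    (exists w s1 s2, [/\ w \notin x |: nb x, s1 \in S & s2 \in S] /\
       [/\ e s1 w, e s2 w & s1 != s2]) ->
  has_completely_independent_spanning_trees 2 e.
Proof.
move=> Sx cB dW gS extra.
have SA s : s \in S -> s \in x |: S by rewrite in_setU1 => ->; rewrite orbT.
have xA : x \in x |: S by rewrite in_setU1 eqxx.
have xS s : s \in S -> x != s.
  by move=> sS; apply/eqP => xs; have := subsetP Sx s sS; rewrite inE xs e_irr.
have viaP u v s p : u \in S -> v \notin x |: S -> s \in S -> p \in nb x :\: S ->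
    e s p -> (s != u) || (p != v) -> connect (cross_minus e (x |: S) u v) x s.
  move=> uS vA sS pP esp ne; have pA := notin_star pP.
  apply: (@connect_trans _ _ p); apply: connect1.
    apply: cross_minus_edge => //; rewrite ?xS //; first exact: SA.
    by move: pP; rewrite !inE => /andP[].
  rewrite (cross_minus_sym e_simple).
  by apply: cross_minus_edge => //; apply: SA.
case: extra => [[s [p1 [p2 [[sS p1P p2P] [e1 e2 p12]]]]]
  |[w [s1 [s2 [[wW s1S s2S] [e1 e2 s12]]]]]].
- have p2A := notin_star p2P.
  apply: (cist_star Sx cB sS p2A e2).
    move=> s' s'S; have [->|ss'] := eqVneq s' s.
      by apply: (viaP _ _ _ _ _ _ _ p1P) => //; rewrite p12 orbT.
    have [p pP ep] := gS s' s'S.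
    by apply: (viaP _ _ _ _ _ _ _ pP) => //; rewrite ss'.
  move=> w wW; have [s' s'S es'] := dW w wW; exists s' => //.
  apply: cross_minus_edge => //; try exact: SA; first exact: far_notin_star.
  apply/orP; right; apply: contraNneq wW => ->.
  by move: p2P; rewrite !inE => /andP[_ ->]; rewrite orbT.
- have wA := far_notin_star Sx wW.
  apply: (cist_star Sx cB s2S wA e2).
    move=> s sS; have [p pP ep] := gS s sS.
    apply: (viaP _ _ _ _ _ _ _ pP) => //; apply/orP; right.
    by apply: contraNneq wW => <-; move: pP; rewrite !inE => /andP[_ ->]; rewrite orbT.
  move=> w' w'W; have [->|ww'] := eqVneq w' w.
    by exists s1 => //; apply: cross_minus_edge => //; try exact: SA; rewrite s12.
  have [s' s'S es'] := dW w' w'W; exists s' => //.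
  apply: cross_minus_edge => //; try exact: SA; first exact: far_notin_star.
  by rewrite ww' orbT.
Qed.

(** The vertices of [S] and the far ones are reached as before, avoiding [p]. Of the two cross edges
    at [p], the one to [b2] is deleted and the one to [b1] attaches [p]. *)
Lemma cist_dominating_add x S p :
    S \subset nb x -> p \in nb x :\: S ->
    connected_in e (~: (x |: (p |: S))) ->
    (forall w, w \notin x |: nb x -> exists2 s, s \in S & e s w) ->
    (forall s, s \in S -> exists2 p', p' \in nb x :\: (p |: S) & e s p') ->
    (exists b1 b2, [/\ b1 \notin x |: (p |: S), b2 \notin x |: (p |: S) & b1 != b2] /\
       e p b1 /\ e p b2) ->
  has_completely_independent_spanning_trees 2 e.
Proof.
move=> Sx pP cB dW gS [b1 [b2 [[b1A b2A b12] [e1 e2]]]].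
have xp : e x p by move: pP; rewrite !inE => /andP[].
have pS : p \notin S by move: pP; rewrite !inE => /andP[].
have Sx' : p |: S \subset nb x by rewrite subUset sub1set inE xp.
have pA : p \in x |: (p |: S) by rewrite !inE eqxx orbT.
have SA s : s \in S -> s \in x |: (p |: S) by rewrite !in_setU1 => ->; rewrite !orbT.
have xA : x \in x |: (p |: S) by rewrite in_setU1 eqxx.
have sp s : s \in S -> s != p by move=> sS; apply: contraNneq pS => <-.
have xnp : x != p by apply: contraTneq xp => <-; rewrite e_irr.
have toP p' : p' \in nb x :\: (p |: S) ->
    cross_minus e (x |: (p |: S)) p b2 x p'.
  move=> p'P; apply: cross_minus_edge => //; rewrite ?xnp ?notin_star //.
  by move: p'P; rewrite in_setD inE => /andP[].
have toS s : s \in S -> connect (cross_minus e (x |: (p |: S)) p b2) x s.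
  move=> sS; have [p' p'P ep'] := gS s sS.
  apply: connect_trans (connect1 (toP _ p'P)) (connect1 _).
  rewrite (cross_minus_sym e_simple).
  by apply: cross_minus_edge => //; rewrite ?notin_star ?sp //; apply: SA.
have toW w : w \notin x |: nb x ->
    exists2 s, s \in S & cross_minus e (x |: (p |: S)) p b2 s w.
  move=> wW; have [s sS es] := dW w wW; exists s => //.
  have wA := far_notin_star Sx' wW.
  by apply: cross_minus_edge => //; rewrite ?sp //; apply: SA.
have pS' : p \in p |: S by rewrite in_setU1 eqxx.
apply: (cist_star Sx' cB pS' b2A e2).
  move=> s /setU1P[->|/toS//].
  have pb1 : cross_minus e (x |: (p |: S)) p b2 b1 p.
    rewrite (cross_minus_sym e_simple).
    by apply: cross_minus_edge => //; rewrite ?b12 ?orbT.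
  apply: connect_trans (connect1 pb1).
  have [/toW[s' s'S es']|] := boolP (b1 \notin x |: nb x).
    exact: connect_trans (toS _ s'S) (connect1 es').
  rewrite negbK => b1x; apply/connect1/toP.
  move: b1x b1A; rewrite in_setD !in_setU1 !negb_or => /predU1P[->|->].
    by rewrite eqxx.
  by rewrite andbT => /andP[_ /andP[-> ->]].
by move=> w /toW[s sS es]; exists s => //; rewrite in_setU1 sS orbT.
Qed.

(** The cross path [x], [p'], [p], [w], [s] reaches both leaves of the star, and [s] reaches all far
    vertices; [p z] is the deleted edge. *)
Lemma cist_dominating_pair x s p p' w z :
    e x s -> e x p -> s != p -> connected_in e (~: (x |: (p |: [set s]))) ->
    (forall w, w \notin x |: nb x -> e s w) ->
    e p p' -> e x p' -> p' != s -> e p w -> w \notin x |: nb x ->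
    e p z -> z != x -> z != s -> z != p' -> z != w ->
  has_completely_independent_spanning_trees 2 e.
Proof.
move=> xs xp sp cB dW pp' xp' p's pw wW pz zx zs zp' zw.
have Sx : p |: [set s] \subset nb x.
  by rewrite subUset !sub1set !inE xp.
set S := p |: [set s] in cB Sx.
have sS : s \in S by rewrite !inE eqxx orbT.
have pS : p \in S by rewrite !inE eqxx.
have SA t : t \in S -> t \in x |: S by rewrite in_setU1 => ->; rewrite orbT.
have xA : x \in x |: S by rewrite in_setU1 eqxx.
have xnp : x != p by apply: contraTneq xp => <-; rewrite e_irr.
have zA : z \notin x |: S.
  rewrite !inE (negbTE zx) (negbTE zs) orbF /=.
  by apply: contraTneq pz => ->; rewrite e_irr.
have p'A : p' \notin x |: S.
  apply: notin_star; rewrite !inE xp' (negbTE p's) orbF andbT.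
  by apply: contraTneq pp' => ->; rewrite e_irr.
have wA := far_notin_star Sx wW.
have cp : connect (cross_minus e (x |: S) p z) x p.
  apply: (@connect_trans _ _ p'); apply: connect1.
    by apply: cross_minus_edge => //; rewrite ?xnp //; apply: SA.
  rewrite (cross_minus_sym e_simple).
  by apply: cross_minus_edge => //; rewrite ?(eq_sym p') ?zp' ?orbT //; apply: SA.
apply: (cist_star Sx cB pS zA pz).
  move=> t /setU1P[->//|/set1P->]; apply: connect_trans cp _.
  apply: (@connect_trans _ _ w); apply: connect1.
    by apply: cross_minus_edge => //; rewrite ?(eq_sym w) ?zw ?orbT //; apply: SA.
  rewrite (cross_minus_sym e_simple).
  by apply: cross_minus_edge => //; rewrite ?dW ?sp //; apply: SA.
move=> w' w'W; exists s => //; have w'A := far_notin_star Sx w'W.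
by apply: cross_minus_edge => //; rewrite ?dW ?sp //; apply: SA.
Qed.
End Star.

(** * Consequences of the degree condition *)

Lemma exists_notin (T : finType) (A D : {set T}) :
  #|D| < #|A| -> exists2 y, y \in A & y \notin D.
Proof.
move=> lt; apply/subsetPn; apply: contraL lt => /subset_leq_card.
by rewrite -leqNgt.
Qed.

Lemma exists_notin_seq (T : finType) (A : {set T}) (D : seq T) :
  size D < #|A| -> exists2 y, y \in A & y \notin D.
Proof.
move=> lt; have [|y yA yD] := @exists_notin T A [set y in D].
  by apply: leq_ltn_trans lt; rewrite cardsE card_size.
by exists y; rewrite inE in yD.
Qed.

(** * Complete bipartite graphs *)

Section CompleteBipartite.
Variables (T : finType) (e : rel T).
Hypothesis e_simple : simple_graph e.
Let e_sym : symmetric e := proj1 e_simple.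

Lemma bipartite_connected (X C : {set T}) a b :
    (forall y z, y \in X -> z \notin X -> e y z) ->
    a \in C -> a \in X -> b \in C -> b \notin X ->
  connected_in e C.
Proof.
move=> eX aC aX bC bX.
have ca v : v \in C -> connect (induced e C) a v.
  move=> vC; have ab : connect (induced e C) a b.
    by apply: connect1; rewrite /induced /= aC bC eX.
  have [vX|vX] := boolP (v \in X); last first.
    by apply: connect1; rewrite /induced /= aC vC eX.
  apply: connect_trans ab (connect1 _).
  by rewrite /induced /= bC vC e_sym eX.
move=> u v uC vC; apply: connect_trans (ca v vC).
by rewrite (connect_induced_sym e_simple) ca.
Qed.

(* A consists of two vertices of each side. The cross graph has two complete
   bipartite components, and f turns a 4-cycle of each of them around. *)
Lemma cist_complete_bipartite (X : {set T}) :
    (forall y z, y \in X -> z \notin X -> e y z) ->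
    4 <= #|X| -> 4 <= #|~: X| ->
  has_completely_independent_spanning_trees 2 e.
Proof.
move=> eX X4 Y4.
have pick4 (C : {set T}) : 4 <= #|C| -> exists a b c d,
    [/\ a \in C, b \in C, c \in C & d \in C] /\ uniq [:: a; b; c; d].
  move=> C4; have [|a aC _] := @exists_notin_seq T C [::]; first by rewrite /=; lia.
  have [|b bC ba] := @exists_notin_seq T C [:: a]; first by rewrite /=; lia.
  have [|c cC ca] := @exists_notin_seq T C [:: b; a]; first by rewrite /=; lia.
  have [|d dC da] := @exists_notin_seq T C [:: c; b; a]; first by rewrite /=; lia.
  by exists d, c, b, a; split; rewrite //= da ca ba.
have [x1 [x2 [x3 [x4 [[X1 X2 X3 X4'] ux]]]]] := pick4 _ X4.
have [y1 [y2 [y3 [y4 [[Y1 Y2 Y3 Y4'] uy]]]]] := pick4 _ Y4.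
rewrite !in_setC in Y1 Y2 Y3 Y4'.
have neq y z : y \in X -> z \notin X -> (y == z) = false.
  by move=> yX; apply: contraNF => /eqP <-.
have distinct (a b c d : T) : uniq [:: a; b; c; d] ->
    [/\ (b == a) = false, (c == a) = false & (d == a) = false] /\
    [/\ (c == b) = false, (d == b) = false & (d == c) = false].
  rewrite /= !inE !negb_or => /and3P[/and3P[ab ac ad] /andP[bc bd] /andP[cd _]].
  by split; split; rewrite eq_sym; apply: negbTE.
have [[x12 x13 x14] [x23 x24 x34]] := distinct _ _ _ _ ux.
have [[y12 y13 y14] [y23 y24 y34]] := distinct _ _ _ _ uy.
pose A := [set x1; x2; y1; y2].
have AX v : v \in X -> (v \in A) = (v == x1) || (v == x2).
  by move=> vX; rewrite !inE (neq v y1) ?(neq v y2) ?orbF.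
have AY v : v \notin X -> (v \in A) = (v == y1) || (v == y2).
  move=> vX; rewrite !inE (eq_sym v x1) (eq_sym v x2).
  by rewrite (neq x1 v) ?(neq x2 v).
(* The cycles are [x1], [y3], [x2], [y4] and [x3], [y2], [x4], [y1]. The remaining vertices are sent
   to [y1] or [x1]. *)
pose f v := if v \in X then
    if v == x1 then y3 else if v == x2 then y4 else if v == x3 then y2 else y1
  else
    if v == y1 then x3 else if v == y2 then x4 else if v == y3 then x2 else x1.
have fx1 : f x1 = y3 by rewrite /f X1 eqxx.
have fx2 : f x2 = y4 by rewrite /f X2 x12 eqxx.
have fx3 : f x3 = y2 by rewrite /f X3 x13 x23 eqxx.
have fx4 : f x4 = y1 by rewrite /f X4' x14 x24 x34.
have fy1 : f y1 = x3 by rewrite /f (negbTE Y1) eqxx.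
have fy2 : f y2 = x4 by rewrite /f (negbTE Y2) y12 eqxx.
have fy3 : f y3 = x2 by rewrite /f (negbTE Y3) y13 y23 eqxx.
have fy4 : f y4 = x1 by rewrite /f (negbTE Y4') y14 y24 y34.
apply: (@cist_of_partition _ _ e_simple A f).
- by apply/set0Pn; exists x1; rewrite AX // eqxx.
- by apply/set0Pn; exists x3; rewrite in_setC AX // x13 x23.
- apply: (@bipartite_connected X _ x1 y1) => //; first by rewrite AX // eqxx.
  by rewrite AY // eqxx.
- apply: (@bipartite_connected X _ x3 y3) => //; rewrite in_setC.
    by rewrite AX // x13 x23.
  by rewrite AY // y13 y23.
- move=> v; rewrite /f; have [vX|vX] := boolP (v \in X).
    by repeat case: ifP => _; apply: eX.
  by repeat case: ifP => _; rewrite e_sym; apply: eX.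
- move=> v; rewrite /f; have [vX|vX] := boolP (v \in X).
    rewrite (AX v vX); case: ifP => _; first by rewrite AY // y13 y23.
    case: ifP => _; first by rewrite AY // y14 y24.
    by case: ifP => _; rewrite AY // eqxx ?orbT.
  rewrite (AY v vX); case: ifP => _; first by rewrite AX // x13 x23.
  case: ifP => _; first by rewrite AX // x14 x24.
  by case: ifP => _; rewrite AX // eqxx ?orbT.
- move=> v; have [vX|vX] := boolP (v \in X).
    have [->|n1] := eqVneq v x1; first by rewrite fx1 fy3 x12.
    have [->|n2] := eqVneq v x2; first by rewrite fx2 fy4 eq_sym x12.
    have [->|n3] := eqVneq v x3; first by rewrite fx3 fy2 x34.
    have -> : f v = y1 by rewrite /f vX (negbTE n1) (negbTE n2) (negbTE n3).
    by rewrite fy1 eq_sym.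
  have [->|n1] := eqVneq v y1; first by rewrite fy1 fx3 y12.
  have [->|n2] := eqVneq v y2; first by rewrite fy2 fx4 eq_sym y12.
  have [->|n3] := eqVneq v y3; first by rewrite fy3 fx2 y34.
  have -> : f v = x1.
    by rewrite /f (negbTE vX) (negbTE n1) (negbTE n2) (negbTE n3).
  by rewrite fx1 eq_sym.
Qed.
End CompleteBipartite.

(** * Common neighbours, and connectedness outside a star *)

Section Hub.
Variables (T : finType) (e : rel T).
Hypothesis e_simple : simple_graph e.
Local Notation nb v := [set w | e v w].
(** Distinct nonadjacent vertices with a common neighbour are the pairs at distance 2, so this is
    the bound [mu2] at least n. *)
Hypothesis ore : forall u v z, u != v -> ~~ e u v -> e u z -> e v z ->
  #|T| <= #|nb u| + #|nb v|.
Implicit Types (S B : {set T}) (u v w x y z : T) (D Z : seq T).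

Let e_sym : symmetric e := proj1 e_simple.
Let e_irr : irreflexive e := proj2 e_simple.

Lemma edge_neq u v : e u v -> u != v.
Proof. by apply: contraTneq => ->; rewrite e_irr. Qed.

Lemma connect_edge B u v : u \in B -> v \in B -> e u v ->
  connect (induced e B) u v.
Proof. by move=> uB vB euv; apply: connect1; rewrite /induced /= uB vB. Qed.

Lemma connect_path2 B u v y : u \in B -> v \in B -> y \in B -> e u y -> e v y ->
  connect (induced e B) u v.
Proof.
move=> uB vB yB uy vy; apply: connect_trans (connect_edge uB yB uy) _.
by apply: connect_edge; rewrite // e_sym.
Qed.

Lemma pivot_connected B y :
  (forall v, v \in B -> connect (induced e B) v y) -> connected_in e B.
Proof.
move=> cy u v uB vB; apply: connect_trans (cy u uB) _.
by rewrite (connect_induced_sym e_simple) cy.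
Qed.

(** Inclusion and exclusion: the union of the two neighbourhoods avoids [Z], so their intersection
    has at least [size Z] elements. *)
Lemma common_neighbour u v z Z D :
    u != v -> ~~ e u v -> e u z -> e v z ->
    uniq Z -> all (fun y => ~~ e u y && ~~ e v y) Z -> size D < size Z ->
  exists y, [/\ e u y, e v y & y \notin D].
Proof.
move=> uv nuv uz vz uZ /allP aZ DZ.
have [|y yI yD] := @exists_notin_seq T (nb u :&: nb v) D.
  have disj : nb u :|: nb v \subset ~: [set y in Z].
    apply/subsetP => y; rewrite in_setC !inE; apply: contraL => /aZ.
    by rewrite negb_or.
  have := subset_leq_card disj; have := cardsC [set y in Z].
  have := cardsUI (nb u) (nb v); have := ore uv nuv uz vz.
  have : #|[set y in Z]| = size Z by rewrite cardsE; apply/card_uniqP.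
  lia.
by exists y; move: yI; rewrite !inE => /andP[].
Qed.

(** The vertices [u] and [v] are themselves adjacent to neither of the two, which gives at least two
    common neighbours. *)
Lemma second_common_neighbour u v z : u != v -> ~~ e u v -> e u z -> e v z ->
  exists y, [/\ e u y, e v y & y != z].
Proof.
move=> uv nuv uz vz.
have [|||y [uy vy]] := common_neighbour uv nuv uz vz (Z := [:: u; v]) (D := [:: z]).
- by rewrite /= inE uv.
- by rewrite /= !e_irr (e_sym v) nuv.
- by [].
by rewrite inE => yz; exists y.
Qed.

Section Centre.
Variable x : T.
Hypothesis hub_dom : forall w, w \notin x |: nb x -> exists2 z, e x z & e w z.

Lemma farE w : (w \notin x |: nb x) = (w != x) && ~~ e x w.
Proof. by rewrite !inE negb_or. Qed.

(** The vertex [x] is adjacent neither to itself nor to [w] and can be added to [Z]; hence the weak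
    inequality between the sizes. *)
Lemma far_neighbour w Z D :
    w \notin x |: nb x -> uniq Z ->
    all (fun y => (y \notin x |: nb x) && ~~ e w y) Z -> size D <= size Z ->
  exists y, [/\ e x y, e w y & y \notin D].
Proof.
move=> wW uZ /allP aZ DZ; have [z xz wz] := hub_dom wW.
move: (wW); rewrite farE => /andP[wx xw].
apply: (@common_neighbour x w z (x :: Z) D) => //; first by rewrite eq_sym.
- rewrite /= uZ andbT; apply/negP => /aZ /andP[].
  by rewrite farE eqxx.
- rewrite /= e_irr (e_sym w) xw /=; apply/allP => y /aZ.
  by rewrite farE -andbA => /and3P[_ -> ->].
Qed.

Lemma hub_neq s : e x s -> s != x.
Proof. by move=> xs; rewrite eq_sym edge_neq. Qed.

Lemma card_hub : #|T| = 1 + #|nb x| + #|~: (x |: nb x)|.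
Proof. by rewrite -(cardsC (x |: nb x)) cardsU1 inE e_irr. Qed.

(** Let [w] be private to [s], that is, far with [s] as its only neighbour in [S]. Then [w] and any
    other neighbour of [s] outside the star are adjacent or have a second common neighbour, which is
    also outside the star. So all neighbours of [s] there are connected to [w]. *)
Lemma private_connected S :
    S \subset nb x ->
    (forall w, w \notin x |: nb x -> exists2 s, s \in S & e s w) ->
    (forall s, s \in S -> exists w, [/\ w \notin x |: nb x, e s w &
       forall t, t \in S -> e t w -> t = s]) ->
    (exists2 p, e x p & p \notin S) ->
  connected_in e (~: (x |: S)).
Proof.
move=> Sx dom priv [p0 xp0 p0S].
set B := ~: (x |: S).
have BE v : (v \in B) = (v != x) && (v \notin S).
  by rewrite in_setC in_setU1 negb_or.
have farB w : w \notin x |: nb x -> w \in B.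
  by move=> wW; rewrite in_setC (far_notin_star Sx wW).
have hubB p : e x p -> p \notin S -> p \in B by move=> xp pS; rewrite BE hub_neq.
have far_neq w y : w \notin x |: nb x -> e w y -> y != x.
  rewrite farE => /andP[_ xw] wy; apply: contraNneq xw => <-.
  by rewrite e_sym.
have toPriv s w b : w \notin x |: nb x -> e s w ->
    (forall t, t \in S -> e t w -> t = s) -> b \in B -> e s b ->
    connect (induced e B) b w.
  move=> wW sw wS bB sb.
  have [->|bw] := eqVneq b w; first exact: connect0.
  have [ebw|nbw] := boolP (e b w); first exact: connect_edge bB (farB _ wW) ebw.
  rewrite e_sym in sb; rewrite e_sym in sw.
  have [y [eby wy ys]] := second_common_neighbour bw nbw sb sw.
  apply: (connect_path2 bB (farB _ wW) _ eby wy); rewrite BE (far_neq w) //=.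
  by apply: contra ys => yS; rewrite (wS y yS) // e_sym.
have toHub s w : w \notin x |: nb x -> (forall t, t \in S -> e t w -> t = s) ->
    exists p, [/\ e x p, p \notin S & connect (induced e B) w p].
  move=> wW wS.
  have [|||p [xp wp]] := far_neighbour wW (Z := [:: w]) (D := [:: s]) => //.
    by rewrite /= wW e_irr.
  rewrite inE => ps.
  have pS : p \notin S by apply: contra ps => pS; rewrite (wS p) // e_sym.
  exists p; split=> //; exact: connect_edge (farB _ wW) (hubB _ xp pS) wp.
have cP p : e x p -> p \notin S -> connect (induced e B) p p0.
  move=> xp pS; have [->|pp0] := eqVneq p p0; first exact: connect0.
  have [pB p0B] := (hubB p xp pS, hubB p0 xp0 p0S).
  have [epp0|npp0] := boolP (e p p0); first exact: connect_edge.
  have [||y [py p0y yx]] := @second_common_neighbour p p0 x pp0 npp0.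
  - by rewrite e_sym.
  - by rewrite e_sym.
  have [yS|yS] := boolP (y \in S); last first.
    by apply: (connect_path2 pB p0B _ py p0y); rewrite BE yx.
  (* The two vertices are joined through the private vertex of y. *)
  rewrite e_sym in py; rewrite e_sym in p0y.
  have [w [wW yw wS]] := priv y yS.
  apply: connect_trans (toPriv y w p wW yw wS pB py) _.
  rewrite (connect_induced_sym e_simple).
  exact: toPriv wW yw wS p0B p0y.
apply: (@pivot_connected _ p0) => v vB.
have [vW|] := boolP (v \notin x |: nb x).
  have [s sS sv] := dom v vW; have [w [wW sw wS]] := priv s sS.
  have [p [xp pS cp]] := toHub s w wW wS.
  apply: connect_trans (toPriv s w v wW sw wS vB sv) _.
  exact: connect_trans cp (cP p xp pS).
rewrite farE negb_and !negbK; move: vB; rewrite BE => /andP[/negbTE-> vS] /= xv.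
exact: cP.
Qed.
End Centre.
End Hub.

(** * A single neighbour of the centre dominates the far vertices *)

Section OneDominator.
Variables (T : finType) (e : rel T).
Hypothesis e_simple : simple_graph e.
Local Notation nb v := [set w | e v w].
Hypothesis ore : forall u v z, u != v -> ~~ e u v -> e u z -> e v z ->
  #|T| <= #|nb u| + #|nb v|.
Hypothesis card_T : 7 <= #|T|.
Implicit Types (S B : {set T}) (s u v w x y z : T) (D Z : seq T).

Let e_sym : symmetric e := proj1 e_simple.
Let e_irr : irreflexive e := proj2 e_simple.

(** A star with one leaf [s] suffices if [s] has degree at least 3 and removing [x] and [s] leaves a
    connected graph. If the graph is not complete, [s] is chosen among two nonadjacent vertices,
    whose degrees add up to at least 7. *)
Lemma cist_universal x : (forall y, y != x -> e x y) ->
  has_completely_independent_spanning_trees 2 e.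
Proof.
move=> univ.
suff [s [sx s3 cB]] : exists s, [/\ s != x, 3 <= #|nb s|
    & connected_in e (~: (x |: [set s]))].
  have inP p : p != x -> e s p -> p \in nb x :\: [set s].
    move=> px sp; rewrite !inE univ // andbT.
    by apply: contraTneq sp => ->; rewrite e_irr.
  have [|p1 p1s p1x] := @exists_notin_seq T (nb s) [:: x]; first by apply: leq_trans s3.
  have [|p2 p2s] := @exists_notin_seq T (nb s) [:: x; p1]; first by apply: leq_trans s3.
  rewrite !inE in p1s p2s p1x *; rewrite negb_or => /andP[p2x p21].
  apply: (cist_dominating e_simple (x := x) (S := [set s])) => //.
  - by rewrite sub1set inE univ.
  - by move=> w; rewrite farE => /andP[/univ->].
  - by move=> t /set1P->; exists p1; first exact: inP.
  - left; exists s, p1, p2; rewrite set11 !inP // p1s p2s; split=> //.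
    by split=> //; rewrite eq_sym.
have [/forallP cpl|/forallPn[u /forallPn[v]]] :=
    boolP [forall u, forall v, (u != v) ==> e u v].
  have cplE u v : u != v -> e u v by move/forallP: (cpl u) => /(_ v)/implyP.
  have [|s _] := @exists_notin_seq T [set: T] [:: x].
    by rewrite cardsT; apply: leq_trans card_T.
  rewrite inE => sx; exists s; split=> //.
    rewrite (_ : nb s = [set~ s]) ?cardsC1; first by move: card_T; clear; lia.
    apply/setP => y; rewrite !inE; have [->|ys] := eqVneq y s; first exact: e_irr.
    by apply: cplE; rewrite eq_sym.
  move=> p q pB qB; have [->|pq] := eqVneq p q; first exact: connect0.
  exact: connect_edge (cplE _ _ pq).
rewrite negb_imply => /andP[uv nuv].
have nx z z' : ~~ e z z' -> z != z' -> z != x.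
  by move=> nz zz'; apply: contraNneq nz => zx; rewrite zx univ // -zx eq_sym.
have [ux vx] : u != x /\ v != x.
  by split; [apply: nx nuv uv | apply: (nx v u); rewrite 1?e_sym 1?eq_sym].
have duv : #|T| <= #|nb u| + #|nb v|.
  by apply: (ore uv nuv (z := x)); rewrite e_sym univ.
have [s [z [sx zx sz nsz s3]]] : exists s z,
    [/\ s != x, z != x, s != z, ~~ e s z & 3 <= #|nb s|].
  have [u3|u3] := leqP 3 #|nb u|; first by exists u, v.
  by exists v, u; split; rewrite ?(eq_sym v u) ?(e_sym v u) //; move: duv u3 card_T; clear; lia.
exists s; split=> //.
(* Since z is not adjacent to s, it shares with every vertex besides x a
   neighbour other than s. *)
apply: (@pivot_connected _ _ e_simple _ z) => q qB.
have zB : z \in ~: (x |: [set s]) by rewrite !inE negb_or zx eq_sym.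
have [->|qz] := eqVneq q z; first exact: connect0.
have [eqz|nqz] := boolP (e q z); first exact: connect_edge.
have qx : q != x by move: qB; rewrite !inE negb_or => /andP[].
have [||y [qy zy yx]] := second_common_neighbour e_simple ore qz nqz (z := x).
- by rewrite e_sym univ.
- by rewrite e_sym univ.
apply: (connect_path2 e_simple _ _ _ qy zy) => //; rewrite !inE negb_or yx /=.
by apply: contraTneq zy => ->; rewrite e_sym.
Qed.

Section Centre.
Variable x : T.
Hypothesis hub_dom : forall w, w \notin x |: nb x -> exists2 z, e x z & e w z.
Hypothesis hub_max : forall y, #|nb y| <= #|nb x|.

Local Notation dominates s := (forall w, w \notin x |: nb x -> e s w).

(** For the star with the single leaf [s] every far vertex is private, so the complement is
    connected; [p1] and [p2] provide the edge to delete. *)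
Lemma cist_dominator_two s p1 p2 w :
    e x s -> dominates s -> w \notin x |: nb x -> e x p1 -> e x p2 ->
    e s p1 -> e s p2 -> p1 != p2 ->
  has_completely_independent_spanning_trees 2 e.
Proof.
move=> xs dom wW xp1 xp2 sp1 sp2 p12.
have inP p : e x p -> e s p -> p \in nb x :\: [set s].
  by move=> xp sp; rewrite !inE xp andbT eq_sym (edge_neq e_simple).
have Sx : [set s] \subset nb x by rewrite sub1set inE.
apply: (cist_dominating e_simple Sx).
- apply: (private_connected e_simple ore hub_dom Sx).
  + by move=> v vW; exists s; rewrite ?set11 ?dom.
  + by move=> t /set1P->; exists w; split; rewrite ?dom // => t' /set1P.
  + by exists p1; have := inP p1 xp1 sp1; rewrite !inE => /andP[].
- by move=> v vW; exists s; rewrite ?set11 ?dom.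
- by move=> t /set1P->; exists p1; first exact: inP.
- by left; exists s, p1, p2; rewrite set11 !inP.
Qed.

Hypothesis few : forall s p1 p2, e x s -> dominates s -> e x p1 -> e x p2 ->
  e s p1 -> e s p2 -> p1 = p2.

(** The star gets the leaves [s] and [p], for some other [p] in N. The cross neighbour of [s] in N
    is [p0], and [p] has degree at least 3. Outside the star everything is linked to some [p1] in
    N. *)
Lemma cist_dominator_one s p0 :
    e x s -> dominates s -> e x p0 -> e s p0 ->
  has_completely_independent_spanning_trees 2 e.
Proof.
move=> xs dom xp0 sp0; pose W := ~: (x |: nb x).
have WE w : (w \in W) = (w \notin x |: nb x) by rewrite in_setC.
have sW p : e x p -> p != p0 -> ~~ e s p.
  by move=> xp; apply: contra => sp; rewrite (few xs dom xp xp0 sp sp0).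
have cT := card_hub e_simple x; rewrite -/W in cT.
have x_far : x \notin W by rewrite !inE eqxx.
have p0_far : p0 \notin x |: W.
  by rewrite !inE negb_or (hub_neq e_simple xp0) xp0 orbT.
have ds : #|nb s| = #|W| + 2.
  rewrite (_ : nb s = p0 |: (x |: W)); first by rewrite !cardsU1 x_far p0_far; clear; lia.
  apply/setP => y; rewrite in_setU1 in_setU1 WE farE inE.
  have [->|yx] := eqVneq y x; first by rewrite e_sym xs orbT.
  have [->|yp0] := eqVneq y p0; first by rewrite sp0.
  have [xy|xy] := boolP (e x y); first by apply/negbTE/sW.
  by rewrite dom // farE yx.
have Wle : #|W| + 2 <= #|nb x| by rewrite -ds hub_max.
have x4 : 4 <= #|nb x| by move: card_T cT Wle; clear; lia.
(* The degrees of the nonadjacent [p] and [s] add up to at least 1 + |N| + |W|, and [s] has degree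
   |W| + 2. *)
have dp p : e x p -> p != p0 -> p != s -> #|nb x| <= #|nb p| + 1.
  move=> xp pp0 ps; have := @ore p s x ps.
  by rewrite e_sym sW // !(e_sym _ x) xp xs => /(_ isT isT isT); move: ds cT; clear; lia.
(* Otherwise the far vertices form a clique attached to s and p only, and p0
   and a far vertex both have degree at most 3. *)
have notall p : e x p -> p != p0 -> p != s ->
    exists w y, [/\ w \notin x |: nb x, e x y, e w y & y \notin [:: s; p]].
  move=> xp pp0 ps.
  have [/existsP[w /andP[wW /existsP[y /and3P[xy wy ysp]]]]|none] := boolP
    [exists w, (w \notin x |: nb x) &&
      [exists y, [&& e x y, e w y & y \notin [:: s; p]]]].
    by exists w, y.
  exfalso.
  have {none} only w y : w \notin x |: nb x -> e x y -> e w y -> y \in [:: s; p].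
    move=> wW xy wy; apply/negPn/negP => ysp; case/negP: none.
    by apply/existsP; exists w; rewrite wW; apply/existsP; exists y; rewrite xy wy.
  have pdom : dominates p.
    move=> w wW.
    have [|||y [xy wy]] := far_neighbour e_simple ore hub_dom wW (Z := [:: w]) (D := [:: s]) => //.
      by rewrite /= wW e_irr.
    by have := only w y wW xy wy; rewrite !inE e_sym => /orP[->//|/eqP <-].
  (* By [only], [p'] has no far neighbours. Missing [s], [p'] and [y], it would have degree at most
     |N| - 2, against [dp]. *)
  have adj p' y : e x p' -> p' \notin [:: s; p0; p] -> y \in [:: p0; p] -> e p' y.
    rewrite !inE !negb_or => xp' /and3P[p's p'p0 p'p] yp; apply/negPn/negP => np'y.
    have xy : e x y by case/orP: yp => /eqP->.
    have ys : y != s.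
      by case/orP: yp => /eqP-> //; rewrite eq_sym (edge_neq e_simple).
    have yp' : y != p' by apply: contraTneq yp => ->; rewrite negb_or p'p0.
    have sub : nb p' \subset x |: (nb x :\ s :\ p' :\ y).
      apply/subsetP => v; rewrite !inE => p'v.
      have [//|vx] := eqVneq v x.
      have xv : e x v.
        apply/negPn/negP => nxv; have vW : v \notin x |: nb x by rewrite farE vx.
        have := only v p' vW xp'; rewrite e_sym p'v !inE => /(_ isT).
        by rewrite (negbTE p's) (negbTE p'p).
      rewrite xv andbT /=; apply/and3P; split.
      - by apply: contraNneq np'y => <-.
      - by rewrite eq_sym (edge_neq e_simple).
      - by apply: contraTneq p'v => ->; rewrite e_sym sW.
    have cs : #|nb x| = 1 + #|nb x :\ s| by rewrite (cardsD1 s) inE xs.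
    have cp' : #|nb x :\ s| = 1 + #|nb x :\ s :\ p'|.
      by rewrite (cardsD1 p') !inE xp' p's.
    have cy : #|nb x :\ s :\ p'| = 1 + #|nb x :\ s :\ p' :\ y|.
      by rewrite (cardsD1 y (_ :\ p')) !inE xy ys yp'.
    have cle : #|nb p'| <= 1 + #|nb x :\ s :\ p' :\ y|.
      by apply: leq_trans (subset_leq_card sub) _; rewrite cardsU1 leq_add2r leq_b1.
    by move: (dp p' xp' p'p0 p's) cle cy cp' cs; clear; lia.
  have [|p' p'x p'n] := @exists_notin_seq T (nb x) [:: s; p0; p]; first by apply: leq_trans x4.
  rewrite inE in p'x.
  have p'p0 : e p' p0 by apply: adj; rewrite // !inE eqxx.
  have p'p : e p' p by apply: adj; rewrite // !inE eqxx orbT.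
  (* By [adj], every vertex of N besides [s], [p0] and [p] is adjacent to [p]; as [p] dominates,
     [few] leaves only one. *)
  have hub4 y : e x y -> y \in [:: s; p0; p; p'].
    move=> xy; have [yin|yn] := boolP (y \in [:: s; p0; p]).
      by move: yin; rewrite !inE => /or3P[]->; rewrite ?orbT.
    have yp : e y p by apply: adj; rewrite // !inE eqxx orbT.
    by rewrite (few xp pdom xy p'x) ?inE ?eqxx ?orbT // e_sym.
  have nep0 : ~~ e p p0.
    apply/negP => ep0; rewrite e_sym in p'p.
    by move: p'p0; rewrite (few xp pdom xp0 p'x ep0 p'p) e_irr.
  have x4' : #|nb x| <= 4.
    apply: leq_trans (card_size [:: s; p0; p; p']).
    by apply: subset_leq_card; apply/subsetP => y; rewrite inE; apply: hub4.
  have [|w wW _] := @exists_notin_seq T W [::]; first by rewrite /=; move: card_T cT x4'; clear; lia.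
  rewrite WE in wW.
  have np0w v : v \notin x |: nb x -> ~~ e p0 v.
    move=> vW; apply/negP; rewrite e_sym => vp0; have := only v p0 vW xp0 vp0.
    by rewrite !inE eq_sym (negbTE (edge_neq e_simple sp0)) eq_sym (negbTE pp0).
  have dp0 : #|nb p0| <= 3.
    apply: leq_trans (card_size [:: x; s; p']).
    apply: subset_leq_card; apply/subsetP => y; rewrite !inE => p0y.
    have [//|yx] := eqVneq y x.
    have [xy|nxy] := boolP (e x y); last first.
      by have := np0w y; rewrite farE yx nxy p0y => /(_ isT).
    move: (hub4 y xy); rewrite !inE => /or4P[->//|/eqP E|/eqP E|->]; last by rewrite orbT.
      by rewrite E e_irr in p0y.
    by rewrite E e_sym (negbTE nep0) in p0y.
  have dw : #|nb w| <= #|W| + 1.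
    have sub : nb w \subset [set s; p] :|: (W :\ w).
      apply/subsetP => y; rewrite inE => wy.
      have [xy|nxy] := boolP (e x y).
        by have := only w y wW xy wy; rewrite !inE => ->.
      have yx : y != x.
        by apply: contraTneq wy => ->; rewrite e_sym; move: wW; rewrite farE => /andP[].
      by rewrite in_setU in_setD1 WE farE yx nxy eq_sym (edge_neq e_simple) // orbT.
    have cw : #|W| = 1 + #|W :\ w| by rewrite (cardsD1 w) WE wW.
    have le := leq_trans (subset_leq_card sub) (leq_card_setU _ _).
    by have := cards2 s p; rewrite eq_sym ps /=; move: cw le; clear; lia.
  (* The degrees add up to at most 3 + (|W| + 1), but n is 1 + 4 + |W|. *)
  have := @ore p0 w s; rewrite np0w // !(e_sym _ s) sp0 dom //.
  have p0w : p0 != w by apply: contraNneq wW => <-; rewrite !inE xp0 orbT.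
  by move=> /(_ p0w isT isT isT); move: dp0 dw cT x4' card_T Wle; clear; lia.
have finish p p1 : e x p -> p != p0 -> p != s -> e x p1 -> p1 \notin [:: s; p0; p] ->
    connect (induced e (~: (x |: (p |: [set s])))) p0 p1 ->
    has_completely_independent_spanning_trees 2 e.
  move=> xp pp0 ps xp1 p1n c01; set B := ~: (x |: (p |: [set s])) in c01.
  have BE v : (v \in B) = [&& v != x, v != p & v != s].
    by rewrite !inE !negb_or.
  move: p1n; rewrite !inE !negb_or => /and3P[p1s p1p0 p1p].
  have p1B : p1 \in B by rewrite BE (hub_neq e_simple xp1) p1p.
  have p0s : p0 != s by rewrite eq_sym (edge_neq e_simple).
  have cP q : e x q -> q != s -> q != p -> connect (induced e B) q p1.
    move=> xq qs qp; have [->//|qp0] := eqVneq q p0.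
    have [->|qp1] := eqVneq q p1; first exact: connect0.
    have qB : q \in B by rewrite BE (hub_neq e_simple) // qp.
    have [eqp1|nqp1] := boolP (e q p1); first exact: connect_edge.
    have qx : e q x by rewrite e_sym.
    have p1x : e p1 x by rewrite e_sym.
    (* Neither [q] nor [p1] is adjacent to [s], so they have at least three common neighbours, one
       of them besides [x] and [p]. *)
    have [|||y [qy p1y]] := common_neighbour ore qp1 nqp1 qx p1x
      (Z := [:: q; p1; s]) (D := [:: x; p]) => //=.
    - by rewrite !inE negb_or qp1 qs p1s.
    - by rewrite !e_irr nqp1 (e_sym p1 q) nqp1 !(e_sym _ s) !sW.
    rewrite !inE negb_or => /andP[yx yp].
    apply: (connect_path2 e_simple _ _ _ qy p1y) => //; rewrite BE yx yp.
    by apply: contraTneq qy => ->; rewrite e_sym sW.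
  have farB w : w \notin x |: nb x -> w \in B.
    move=> wW; rewrite in_setC; apply: (far_notin_star _ wW).
    by rewrite subUset !sub1set !inE xp.
  have hubB q : e x q -> q \notin [:: s; p] -> q \in B /\ connect (induced e B) q p1.
    rewrite in_cons inE negb_or => xq /andP[qs qp]; split; last exact: cP.
    by rewrite BE (hub_neq e_simple) // qp.
  have [w1 [y1 [w1W xy1 w1y1 y1n]]] := notall p xp pp0 ps.
  have cw1 : connect (induced e B) w1 p1.
    have [y1B c1] := hubB y1 xy1 y1n.
    exact: connect_trans (connect_edge (farB _ w1W) y1B w1y1) c1.
  have dp3 : 3 <= #|nb p| by move: (dp p xp pp0 ps) x4; clear; lia.
  have nsp : ~~ e p s by rewrite e_sym sW.
  have [|b1 b1p b1x] := @exists_notin_seq T (nb p) [:: x]; first by apply: leq_trans dp3.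
  have [|b2 b2p b2x] := @exists_notin_seq T (nb p) [:: x; b1]; first by apply: leq_trans dp3.
  rewrite !inE ?negb_or in b1p b2p b1x b2x; case/andP: b2x => b2x b21.
  have bB b : e p b -> b != x -> b \notin x |: (p |: [set s]).
    move=> pb bx; rewrite !inE !negb_or bx eq_sym (edge_neq e_simple) //=.
    by apply: contraNneq nsp => <-.
  apply: (cist_dominating_add e_simple (x := x) (S := [set s]) (p := p)).
  - by rewrite sub1set inE.
  - by rewrite !inE ps.
  - apply: (@pivot_connected _ _ e_simple _ p1) => v vB.
    have [vW|] := boolP (v \notin x |: nb x); last first.
      move: vB; rewrite BE => /and3P[vx vp vs].
      by rewrite farE vx negbK => xv; apply: cP.
    have [->//|vw1] := eqVneq v w1.
    have [evw1|nvw1] := boolP (e v w1).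
      exact: connect_trans (connect_edge vB (farB _ w1W) evw1) cw1.
    (* A far vertex not adjacent to [w1] has at least three common neighbours with [x], one of them
       besides [s] and [p]. *)
    have [|||y [xy vy yn]] := far_neighbour e_simple ore hub_dom vW
      (Z := [:: v; w1]) (D := [:: s; p]) => //.
    + by rewrite /= inE vw1.
    + by rewrite /= vW w1W e_irr nvw1.
    have [yB cy] := hubB y xy yn.
    exact: connect_trans (connect_edge vB yB vy) cy.
  - by move=> w wW; exists s; rewrite ?set11 ?dom.
  - by move=> t /set1P->; exists p0; rewrite // !inE xp0 negb_or p0s eq_sym pp0.
  - by exists b1, b2; rewrite !bB // eq_sym.
have p0s : p0 != s by rewrite eq_sym (edge_neq e_simple).
(* For [p1] serves a neighbour of [p0] in N other than [s], if there is one. Otherwise any [p1]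
   shares with [p0] a neighbour besides [x], which is neither [s] nor [p]. *)
have [/existsP[p1 /and3P[xp1 p1s p01]]|none] := boolP
    [exists p1, [&& e x p1, p1 != s & e p0 p1]].
  have [|p px pn] := @exists_notin_seq T (nb x) [:: s; p0; p1]; first by apply: leq_trans x4.
  move: px pn; rewrite !inE !negb_or => xp /and3P[ps pp0 pp1].
  have p10 : p1 != p0 by rewrite eq_sym (edge_neq e_simple).
  apply: (finish p p1) => //; first by rewrite !inE !negb_or p1s p10 eq_sym.
  apply: connect_edge => //; rewrite !inE !negb_or.
    by rewrite (hub_neq e_simple xp0) p0s eq_sym pp0.
  by rewrite (hub_neq e_simple xp1) p1s eq_sym pp1.
have [|p px pn] := @exists_notin_seq T (nb x) [:: s; p0]; first by apply: leq_trans x4.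
move: px pn; rewrite !inE !negb_or => xp /andP[ps pp0].
have [|p1 p1x p1n] := @exists_notin_seq T (nb x) [:: s; p0; p]; first by apply: leq_trans x4.
move: p1x (p1n); rewrite !inE !negb_or => xp1 /and3P[p1s p10 p1p].
apply: (finish p p1) => //.
have np q : e x q -> q != s -> ~~ e p0 q.
  move=> xq qs; apply: contra none => p0q.
  by apply/existsP; exists q; rewrite xq qs.
have p01 : p0 != p1 by rewrite eq_sym.
have [||y [p0y p1y yx]] := second_common_neighbour e_simple ore p01 (np _ xp1 p1s) (z := x).
- by rewrite e_sym.
- by rewrite e_sym.
have ys : y != s by apply: contraTneq p1y => ->; rewrite e_sym sW.
have yp : y != p by apply: contraTneq p0y => ->; apply: np.
have inB q : q != x -> q != p -> q != s -> q \in ~: (x |: (p |: [set s])).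
  by rewrite !inE !negb_or => -> ->.
apply: (connect_path2 e_simple _ _ _ p0y p1y); apply: inB => //.
- exact: (hub_neq e_simple).
- by rewrite eq_sym.
- exact: (hub_neq e_simple).
Qed.
End Centre.

Section Centre.
Variable x : T.
Hypothesis hub_dom : forall w, w \notin x |: nb x -> exists2 z, e x z & e w z.
Hypothesis hub_max : forall y, #|nb y| <= #|nb x|.

Local Notation dominates s := (forall w, w \notin x |: nb x -> e s w).

(** Here [s] has degree |W| + 1, so the other vertices of N have degree at least |N|. An edge [p p']
    within N permits the star with leaves [s] and [p]. If N is independent, the degrees join every
    vertex of N to all of [x |: W], and the graph is complete bipartite with sides of equal size. *)
Lemma cist_dominator_zero s : e x s -> dominates s ->
    (forall t p, e x t -> dominates t -> e x p -> ~~ e t p) ->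
  has_completely_independent_spanning_trees 2 e.
Proof.
move=> xs dom none; pose W := ~: (x |: nb x).
have WE w : (w \in W) = (w \notin x |: nb x) by rewrite in_setC.
have sP p : e x p -> ~~ e s p by move=> xp; apply: none.
have cT := card_hub e_simple x; rewrite -/W in cT.
have x_far : x \notin W by rewrite !inE eqxx.
have cxW : #|x |: W| = #|W| + 1 by rewrite cardsU1 x_far; clear; lia.
have ds : #|nb s| = #|W| + 1.
  rewrite -cxW; congr #|pred_of_set _|; apply/setP => y.
  rewrite in_setU1 WE farE inE.
  have [->|yx] := eqVneq y x; first by rewrite e_sym xs.
  have [xy|xy] := boolP (e x y); first by apply/negbTE/sP.
  by rewrite dom // farE yx.
have Wle : #|W| + 1 <= #|nb x| by rewrite -ds hub_max.
have x4 : 4 <= #|nb x| by move: card_T cT Wle; clear; lia.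
have dp p : e x p -> p != s -> #|nb x| <= #|nb p|.
  move=> xp ps; have := @ore p s x ps.
  by rewrite e_sym sP // !(e_sym _ x) xp xs => /(_ isT isT isT); move: ds cT; clear; lia.
have [/existsP[p /existsP[p' /and3P[xp xp' pp']]]|indep] := boolP
    [exists p, exists p', [&& e x p, e x p' & e p p']].
  have ps : p != s by apply: contraTneq pp' => ->; apply: sP.
  have p's : p' != s by apply: contraTneq pp' => ->; rewrite e_sym; apply: sP.
  have nps : ~~ e p s by rewrite e_sym sP.
  (* Being adjacent to [p'], [p] does not dominate. The far vertex [w1] that it misses has a
     neighbour in N besides [s], which stays in [B]. *)
  have [w1 w1W npw1] : exists2 w1, w1 \notin x |: nb x & ~~ e p w1.
    have [/existsP[w /andP[wW pw]]|all] := boolP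
      [exists w, (w \notin x |: nb x) && ~~ e p w]; first by exists w.
    have pdom : dominates p.
      move=> w wW; apply/negPn/negP => npw; case/negP: all.
      by apply/existsP; exists w; rewrite wW.
    by have := none p p' xp pdom xp'; rewrite pp'.
  set B := ~: (x |: (p |: [set s])).
  have BE v : (v \in B) = [&& v != x, v != p & v != s].
    by rewrite !inE !negb_or.
  have p'B : p' \in B.
    by rewrite BE (hub_neq e_simple xp') p's andbT eq_sym (edge_neq e_simple pp').
  have Sx : p |: [set s] \subset nb x by rewrite subUset !sub1set !inE xp.
  have farB w : w \notin x |: nb x -> w \in B.
    by move=> wW; rewrite in_setC (far_notin_star Sx wW).
  have cP q : e x q -> q != s -> q != p -> connect (induced e B) q p'.
    move=> xq qs qp.
    have [->|qp'] := eqVneq q p'; first exact: connect0.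
    have qB : q \in B by rewrite BE (hub_neq e_simple) // qp.
    have [eqp'|nqp'] := boolP (e q p'); first exact: connect_edge.
    have qx : e q x by rewrite e_sym.
    have p'x : e p' x by rewrite e_sym.
    have [|||y [qy p'y]] := common_neighbour ore qp' nqp' qx p'x
      (Z := [:: q; p'; s]) (D := [:: x; p]) => //=.
    - by rewrite !inE negb_or qp' qs p's.
    - by rewrite !e_irr nqp' (e_sym p' q) nqp' !(e_sym _ s) !sP.
    rewrite !inE negb_or => /andP[yx yp].
    apply: (connect_path2 e_simple _ _ _ qy p'y) => //; rewrite BE yx yp.
    by apply: contraTneq qy => ->; rewrite e_sym sP.
  have hubB q : e x q -> q \notin [:: s; p] -> q \in B /\ connect (induced e B) q p'.
    rewrite in_cons inE negb_or => xq /andP[qs qp]; split; last exact: cP.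
    by rewrite BE (hub_neq e_simple) // qp.
  have cw1 : connect (induced e B) w1 p'.
    have [|||y [xy wy ys]] := far_neighbour e_simple ore hub_dom w1W
      (Z := [:: w1]) (D := [:: s]) => //.
      by rewrite /= w1W e_irr.
    have [|yB cy] := hubB y xy.
      rewrite in_cons negb_or inE; rewrite inE in ys; rewrite ys /=.
      by apply: contraTneq wy => ->; rewrite e_sym.
    exact: connect_trans (connect_edge (farB _ w1W) yB wy) cy.
  have cB : connected_in e B.
    apply: (@pivot_connected _ _ e_simple _ p') => v vB.
    have [vW|] := boolP (v \notin x |: nb x); last first.
      move: vB; rewrite BE => /and3P[vx vp vs].
      by rewrite farE vx negbK => xv; apply: cP.
    have [->//|vw1] := eqVneq v w1.
    have [evw1|nvw1] := boolP (e v w1).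
      exact: connect_trans (connect_edge vB (farB _ w1W) evw1) cw1.
    have [|||y [xy vy yn]] := far_neighbour e_simple ore hub_dom vW
      (Z := [:: v; w1]) (D := [:: s; p]) => //.
    + by rewrite /= inE vw1.
    + by rewrite /= vW w1W e_irr nvw1.
    have [yB cy] := hubB y xy yn.
    exact: connect_trans (connect_edge vB yB vy) cy.
  (* At least |N| neighbours of [p] cannot all lie in [x |: nb x], where only |N| - 1 vertices
     differ from [s] and [p]. *)
  have [|w wp wn] := @exists_notin T (nb p) (x |: (nb x :\ s :\ p)).
    apply: leq_trans (dp p xp ps).
    have cs : #|nb x| = 1 + #|nb x :\ s| by rewrite (cardsD1 s) inE xs.
    have cp : #|nb x :\ s| = 1 + #|nb x :\ s :\ p|.
      by rewrite (cardsD1 p) !inE xp ps.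
    by rewrite cs cp cardsU1 ltnS leq_add2r leq_b1.
  rewrite inE in wp.
  have wW : w \notin x |: nb x.
    move: wn; rewrite !inE; have [//|wx] := eqVneq w x.
    rewrite (eq_sym w p) (edge_neq e_simple wp) /=.
    by have [E|//] := eqVneq w s; rewrite E (negbTE nps) in wp.
  have [|z zp zn] := @exists_notin_seq T (nb p) [:: x; p'; w].
    by apply: leq_trans (dp p xp ps); apply: leq_trans x4.
  move: zp zn; rewrite !inE !negb_or => pz /and3P[zx zp' zw].
  have zs : z != s by apply: contraTneq pz => ->.
  apply: (cist_dominating_pair e_simple xs xp _ cB dom pp' xp' p's wp wW pz) => //.
  by rewrite eq_sym.
have {}indep p q : e x p -> e x q -> ~~ e p q.
  move=> xp xq; apply: contra indep => pq.
  by apply/existsP; exists p; apply/existsP; exists q; rewrite xp xq.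
have cW : #|W| + 1 = #|nb x|.
  have [|p px pn] := @exists_notin_seq T (nb x) [:: s]; first by apply: leq_trans x4.
  rewrite !inE in px pn.
  have sub : nb p \subset x |: W.
    apply/subsetP => y; rewrite in_setU1 WE farE inE => py.
    have [//|yx] := eqVneq y x.
    by apply/negP => xy; have := indep p y px xy; rewrite py.
  by move: (subset_leq_card sub) (dp p px pn) cxW Wle; clear; lia.
have cpl y z : y \in nb x -> z \notin nb x -> e y z.
  rewrite !inE => xy xz.
  have [->|zx] := eqVneq z x; first by rewrite e_sym.
  have zW : z \notin x |: nb x by rewrite farE zx.
  have [->|ys] := eqVneq y s; first exact: dom.
  have sub : nb y \subset x |: W.
    apply/subsetP => t; rewrite in_setU1 WE farE inE => yt.
    have [//|tx] := eqVneq t x.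
    by apply/negP => xt; have := indep y t xy xt; rewrite yt.
  have : nb y == x |: W by rewrite eqEcard sub cxW cW dp.
  move/eqP/setP/(_ z); rewrite in_setU1 WE zW orbT inE => ->.
  by [].
apply: (cist_complete_bipartite e_simple cpl x4).
by move: (cardsC (nb x)) cT cW x4; clear; lia.
Qed.

(** The cases are whether some dominator has two neighbours in N, or one, or all dominators have
    none. *)
Lemma cist_one_dominator s : e x s -> dominates s ->
  has_completely_independent_spanning_trees 2 e.
Proof.
move=> xs dom.
have [/existsP[w wW]|none] := boolP [exists w, w \notin x |: nb x]; last first.
  apply: (@cist_universal x) => y yx; apply: contraNT none => nxy.
  by apply/existsP; exists y; rewrite farE yx.
pose domb t := [forall w, (w \notin x |: nb x) ==> e t w].
have domP t : reflect (dominates t) (domb t).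
  by apply: (iffP forallP) => H v; [apply/implyP|apply/implyP]; apply: H.
have [/existsP[t /existsP[p1 /existsP[p2]]]|two] := boolP
    [exists t, exists p1, exists p2, [&& e x t, domb t, e x p1, e x p2
      & [&& e t p1, e t p2 & p1 != p2]]].
  case/and5P=> xt /domP td xp1 xp2 /and3P[tp1 tp2 p12].
  exact: (cist_dominator_two hub_dom xt td wW xp1 xp2 tp1 tp2 p12).
have few t p1 p2 : e x t -> dominates t -> e x p1 -> e x p2 ->
    e t p1 -> e t p2 -> p1 = p2.
  move=> xt /domP td xp1 xp2 tp1 tp2; apply/eqP; apply: contraNT two => p12.
  apply/existsP; exists t; apply/existsP; exists p1; apply/existsP; exists p2.
  by rewrite xt td xp1 xp2 tp1 tp2.
have [/existsP[t /existsP[p /and4P[xt /domP td xp tp]]]|zero] := boolP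
    [exists t, exists p, [&& e x t, domb t, e x p & e t p]].
  exact: (cist_dominator_one hub_dom hub_max few xt td xp tp).
apply: (cist_dominator_zero xs dom) => t p xt /domP td xp.
apply: contra zero => tp.
by apply/existsP; exists t; apply/existsP; exists p; rewrite xt td xp.
Qed.
End Centre.
End OneDominator.

(** * No single neighbour dominates the far vertices *)

Lemma card_disjoint (T : finType) (W A B : {set T}) :
  A \subset W -> B \subset W :\: A -> #|A| + #|B| <= #|W|.
Proof.
by move=> /setIidPr AW /subset_leq_card; rewrite -(cardsID A W) AW leq_add2l.
Qed.

Section NoDominator.
Variables (T : finType) (e : rel T).
Hypothesis e_simple : simple_graph e.
Local Notation nb v := [set w | e v w].
Hypothesis ore : forall u v z, u != v -> ~~ e u v -> e u z -> e v z ->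
  #|T| <= #|nb u| + #|nb v|.
Hypothesis card_T : 7 <= #|T|.
Implicit Types (S B : {set T}) (s t u v w x y z : T) (D Z : seq T).

Let e_sym : symmetric e := proj1 e_simple.
Let e_irr : irreflexive e := proj2 e_simple.

Local Notation max_degree y := (forall v, #|nb v| <= #|nb y|).

(** If [x], [z], [a], [b] were a shortest path, [z] would have degree at most |N|, and [b], whose
    neighbours are all far, at most |W| - 1. The sum is below n = 1 + |N| + |W|, although [z] and
    [b] share [a]. *)
Lemma max_degree_distance x : connected_graph e -> max_degree x ->
  forall w, w \notin x |: nb x -> exists2 z, e x z & e w z.
Proof.
move=> conn xmax w wW.
pose C := [set v | (v \in x |: nb x) || [exists z, e x z && e v z]].
have closC : closed e C.
  apply: (intro_closed (sym_connect_sym e_sym)) => a b ab.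
  rewrite !inE => /orP[/predU1P[ax|xa]|/existsP[z /andP[xz az]]].
  - by rewrite -ax ab orbT.
  - by apply/orP; right; apply/existsP; exists a; rewrite xa e_sym.
  apply/negPn/negP; rewrite negb_or => /andP[bW' /existsPn far].
  have bW : b \notin x |: nb x by rewrite farE -negb_or.
  have nzb : ~~ e z b by have := far z; rewrite xz e_sym.
  have zb : z != b by apply: contraNneq bW => <-; rewrite !inE xz orbT.
  have := @ore z b a zb nzb; rewrite e_sym az e_sym ab => /(_ isT isT).
  have sub : nb b \subset ~: (x |: nb x) :\ b.
    apply/subsetP => y; rewrite in_setD1 in_setC farE inE => yb.
    rewrite eq_sym (edge_neq e_simple yb) /=; apply/andP; split.
      apply: contraTneq yb => ->; rewrite e_sym.
      by move: bW; rewrite farE => /andP[].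
    by have := far y; rewrite yb andbT.
  have cb : #|~: (x |: nb x)| = 1 + #|~: (x |: nb x) :\ b|.
    by rewrite (cardsD1 b) in_setC bW.
  move: (subset_leq_card sub) (card_hub e_simple x) (xmax z) cb; clear; lia.
have : w \in C.
  rewrite -(closed_connect closC (conn x w)) !inE eqxx //.
by rewrite inE (negbTE wW) => /existsP[z /andP[]]; exists z.
Qed.

(** * Dominating sets of minimum size *)

Section Centre.
Variables x w0 : T.
Hypothesis hub_dom : forall w, w \notin x |: nb x -> exists2 z, e x z & e w z.
Hypothesis hub_max : max_degree x.
Hypothesis far_w0 : w0 \notin x |: nb x.
(** Stated for all vertices of maximum degree because it is also applied to members of [S] that turn
    out to have maximum degree. *)
Hypothesis no_dom : forall y s, max_degree y -> e y s ->
  exists2 w, w \notin y |: nb y & ~~ e s w.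

Local Notation W := (~: (x |: nb x)).

Definition dominating S : bool :=
  (S \subset nb x) &&
    [forall w, (w \notin x |: nb x) ==> [exists s, (s \in S) && e s w]].

Definition min_dominating S : Prop :=
  dominating S /\ forall S', dominating S' -> #|S| <= #|S'|.

Lemma dominatingP S : reflect (S \subset nb x /\
    forall w, w \notin x |: nb x -> exists2 s, s \in S & e s w) (dominating S).
Proof.
apply: (iffP andP) => [[Sx /forallP dom]|[Sx dom]]; split=> //.
  move=> w wW; have /implyP/(_ wW)/existsP[s /andP[]] := dom w.
  by exists s.
apply/forallP => w; apply/implyP => /dom[s sS sw].
by apply/existsP; exists s; rewrite sS.
Qed.

Lemma min_dominating_exists : exists S, min_dominating S.
Proof.
have dx : dominating (nb x).
  apply/dominatingP; split=> // w /hub_dom[z xz wz].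
  by exists z; rewrite ?inE // e_sym.
case: (arg_minnP (fun S : {set T} => #|S|) dx) => S dS minS.
by exists S; split.
Qed.

Lemma inhub S s : min_dominating S -> s \in S -> e x s.
Proof. by case=> /dominatingP[/subsetP Sx _] _ /Sx; rewrite inE. Qed.

(** Otherwise [S :\ s] would still dominate. *)
Lemma min_private S s : min_dominating S -> s \in S ->
  exists w, [/\ w \notin x |: nb x, e s w & forall t, t \in S -> e t w -> t = s].
Proof.
move=> [/dominatingP[Sx dom] minS] sS.
have [/existsP[w /andP[wW /forallP wS]]|none] := boolP
    [exists w, (w \notin x |: nb x) && [forall t, (t \in S) ==> e t w ==> (t == s)]].
  have only t : t \in S -> e t w -> t = s.
    by move=> tS tw; apply/eqP; have := wS t; rewrite tS tw.
  by have [t tS tw] := dom w wW; exists w; split; rewrite // -(only t).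
have : dominating (S :\ s).
  apply/dominatingP; split; first exact: subset_trans (subD1set _ _) Sx.
  move=> w wW; have /existsPn/(_ w) := none.
  rewrite wW /= => /forallPn[t]; rewrite !negb_imply => /and3P[tS tw ts].
  by exists t; rewrite // !inE ts.
by move=> /minS; rewrite (cardsD1 s S) sS ltnn.
Qed.

(** The vertices [x] and [w] have at least two common neighbours, of which only [s] can lie in
    [S]. *)
Lemma private_outside s S w : w \notin x |: nb x ->
    (forall t, t \in S -> e t w -> t = s) ->
  exists p, [/\ e x p, p \notin S & e w p].
Proof.
move=> wW wS.
have [|||p [xp wp ps]] := far_neighbour e_simple ore hub_dom wW
    (Z := [:: w]) (D := [:: s]) => //.
  by rewrite /= wW e_irr.
exists p; split=> //; apply: contra ps => pS.
by rewrite inE (wS p) // e_sym.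
Qed.

Lemma min_nonempty S : min_dominating S -> exists s, s \in S.
Proof. by case=> /dominatingP[_ /(_ _ far_w0)[s]]; exists s. Qed.

Lemma min_outside S : min_dominating S -> exists2 p, e x p & p \notin S.
Proof.
move=> mS; have [s sS] := min_nonempty mS.
have [w [wW _ wS]] := min_private mS sS.
by have [p [xp pS _]] := private_outside wW wS; exists p.
Qed.

Lemma min_connected S : min_dominating S -> connected_in e (~: (x |: S)).
Proof.
move=> mS; have [/dominatingP[Sx dom] _] := mS.
apply: (private_connected e_simple ore hub_dom Sx dom); last exact: min_outside.
by move=> s; apply: min_private.
Qed.

Lemma card_far s : #|W| = #|nb s :&: W| + #|W :\: nb s|.
Proof. by rewrite setIC cardsID. Qed.

Lemma private_choice S : min_dominating S -> exists pw : T -> T,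
  forall s, s \in S -> [/\ pw s \notin x |: nb x, e s (pw s) &
    forall t, t \in S -> e t (pw s) -> t = s].
Proof.
move=> mS; apply: (@fin_all_exists T (fun _ => T) (fun s w => s \in S ->
  [/\ w \notin x |: nb x, e s w & forall t, t \in S -> e t w -> t = s])) => s.
have [sS|sS] := boolP (s \in S); last by exists s.
by have [w wP] := min_private mS sS; exists w.
Qed.

(** Private vertices of the other members are distinct and missed by [s]; this bounds |S| - 1 by the
    number of far vertices that [s] misses. *)
Lemma private_image S s (pw : T -> T) : min_dominating S -> s \in S ->
    (forall s, s \in S -> [/\ pw s \notin x |: nb x, e s (pw s) &
       forall t, t \in S -> e t (pw s) -> t = s]) ->
  pw @: (S :\ s) \subset W :\: nb s /\ #|pw @: (S :\ s)| = #|S :\ s|.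
Proof.
move=> mS sS pwP; split.
  apply/subsetP => _ /imsetP[t /setD1P[ts tS] ->].
  have [tW _ tP] := pwP t tS; rewrite in_setD in_setC tW andbT inE.
  by apply/negP => /(tP _ sS) st; rewrite st eqxx in ts.
apply: card_in_imset => t r /setD1P[_ tS] /setD1P[_ rS] E.
have [_ tw _] := pwP t tS; have [_ _ rP] := pwP r rS.
by apply: rP; rewrite // -E.
Qed.

Lemma min_missing S s : min_dominating S -> s \in S -> #|S| <= #|W :\: nb s| + 1.
Proof.
move=> mS sS; have [pw pwP] := private_choice mS.
have [sub card_im] := private_image mS sS pwP.
by rewrite (cardsD1 s S) sS addnC leq_add2r -card_im subset_leq_card.
Qed.

Lemma degree_split S s : S \subset nb x -> e x s ->
  #|nb s| = 1 + #|nb s :&: S| + #|nb s :&: (nb x :\: S)| + #|nb s :&: W|.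
Proof.
move=> Sx xs; rewrite -(cardsID (x |: nb x) (nb s)) setDE; congr (_ + _).
have -> : nb s :&: (x |: nb x) = x |: (nb s :&: nb x).
  apply/setP => y; rewrite !inE; have [->|] //= := eqVneq y x.
  by rewrite e_sym xs.
rewrite cardsU1 !inE e_irr andbF -addnA; congr (_ + _).
rewrite -(cardsID S (nb s :&: nb x)) -setIA (setIidPr Sx); congr (_ + #|pred_of_set _|).
by apply/setP => y; rewrite !inE andbCA.
Qed.

Lemma card_nb_min S s : s \in S -> #|nb s :&: S| < #|S|.
Proof.
move=> sS; rewrite [X in _ < X](cardsD1 s) sS ltnS; apply: subset_leq_card.
apply/subsetP => y; rewrite !inE => /andP[sy ->].
by rewrite eq_sym (edge_neq e_simple sy).
Qed.

(* Compare s with a vertex p outside S: the degree of p is at most that of x. *)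
Lemma bad_dominator S s : min_dominating S -> s \in S ->
    (forall p, e x p -> p \notin S -> ~~ e s p) ->
  (forall t, t \in S -> t != s -> e s t) /\ #|W :\: nb s| < #|S|.
Proof.
move=> mS sS bad; have [p xp pS] := min_outside mS.
have [/dominatingP[Sx _] _] := mS; have xs := inhub mS sS.
have ps : p != s by apply: contraNneq pS => ->.
have d := @ore p s x ps; rewrite e_sym bad // !(e_sym _ x) xp xs in d.
have {d} d := leq_trans (d isT isT isT) (leq_add (hub_max p) (leqnn _)).
have P0 : nb s :&: (nb x :\: S) = set0.
  apply/setP => y; rewrite !inE; apply/negP => /and3P[sy yS xy].
  by move: (bad y xy yS); rewrite sy.
have split := degree_split Sx xs; rewrite P0 cards0 in split.
have miss := min_missing mS sS; have cW := card_far s.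
have cT := card_hub e_simple x; have lt := card_nb_min sS.
have c1 : #|S| = 1 + #|S :\ s| by rewrite (cardsD1 s S) sS.
split; last by move: d split cW cT lt; clear; lia.
move=> t tS ts.
have sub : nb s :&: S \subset S :\ s.
  apply/subsetP => y; rewrite !inE => /andP[sy ->].
  by rewrite eq_sym (edge_neq e_simple sy).
have : nb s :&: S == S :\ s.
  by rewrite eqEcard sub; move: d split miss cW cT c1; clear; lia.
by move/eqP/setP/(_ t); rewrite !inE ts tS andbT.
Qed.

(** If some [s] in a minimum set [S] has no neighbour in N - S, the far vertices that it misses are
    exactly the private vertices [pw t] of the other members [t]. Replacing each [t] by a neighbour
    [pp t] of [pw t] in N - S gives a minimum set [R]. In it [s] is adjacent to a discarded vertex,
    and a [pp t] without neighbour in N - R would have to be adjacent to [s], which is excluded. *)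
Lemma good_dominating : exists S, min_dominating S /\
  forall s, s \in S -> exists2 p, p \in nb x :\: S & e s p.
Proof.
have [S mS] := min_dominating_exists.
have goodP R r : (exists2 p, p \in nb x :\: R & e r p) \/
    (forall p, e x p -> p \notin R -> ~~ e r p).
  have [/existsP[p /andP[pR rp]]|none] := boolP
    [exists p, (p \in nb x :\: R) && e r p]; first by left; exists p.
  right=> p xp pR; apply: contra none => rp.
  by apply/existsP; exists p; rewrite !inE pR xp.
have [/existsP[s /andP[sS /forallP bad]]|allgood] := boolP
    [exists s, (s \in S) && [forall p, e x p ==> (p \notin S) ==> ~~ e s p]];
    last first.
  exists S; split=> // s sS; case: (goodP S s) => // bad; case/negP: allgood.
  apply/existsP; exists s; rewrite sS; apply/forallP => p.
  by apply/implyP => xp; apply/implyP; apply: bad.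
have {}bad p : e x p -> p \notin S -> ~~ e s p.
  by move=> xp pS; have := bad p; rewrite xp pS.
have [adj lt] := bad_dominator mS sS bad.
have [pw pwP] := private_choice mS.
have [sub card_im] := private_image mS sS pwP.
have [pp ppP] : exists pp : T -> T, forall t, t \in S ->
    [/\ e x (pp t), pp t \notin S & e (pw t) (pp t)].
  apply: (@fin_all_exists T (fun _ => T) (fun t p => t \in S ->
    [/\ e x p, p \notin S & e (pw t) p])) => t.
  have [tS|tS] := boolP (t \in S); last by exists t.
  have [tW _ tP] := pwP t tS.
  by have [p pP] := private_outside tW tP; exists p.
have imE : pw @: (S :\ s) = W :\: nb s.
  apply/eqP; rewrite eqEcard sub card_im.
  by move: lt; rewrite (cardsD1 s S) sS ltnS.
pose R := s |: (pp @: (S :\ s)).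
have dR : dominating R.
  apply/dominatingP; split.
    apply/subsetP => y /setU1P[->|/imsetP[t /setD1P[_ tS] ->]]; rewrite inE.
      exact: inhub mS sS.
    by case: (ppP t tS).
  move=> w wW; have [sw|sw] := boolP (e s w); first by exists s; rewrite ?setU11.
  have : w \in pw @: (S :\ s) by rewrite imE in_setD in_setC wW inE sw.
  case/imsetP=> t tS ->; exists (pp t); first by rewrite setU1r // imset_f.
  by rewrite e_sym; have /setD1P[_ /ppP[]] := tS.
have mR : min_dominating R.
  split=> // S' /(proj2 mS); apply: leq_trans.
  rewrite (cardsD1 s S) sS cardsU1; apply: leq_add; first exact: leq_b1.
  exact: leq_imset_card.
exists R; split=> // r /setU1P[->|/imsetP[t /setD1P[ts tS] ->]].
  have [w wW nsw] := no_dom hub_max (inhub mS sS).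
  have [/dominatingP[_ /(_ w wW)[t tS tw]] _] := mS.
  have ts : t != s by apply: contraNneq nsw => <-.
  exists t; last exact: adj.
  rewrite in_setD inE (inhub mS tS) andbT in_setU1 negb_or ts /=.
  by apply/imsetP => -[r' /setD1P[_ /ppP[_ rS _]] E]; rewrite -E tS in rS.
have [xp pS _] := ppP t tS.
case: (goodP R (pp t)) => // badp.
have ptR : pp t \in R by rewrite setU1r // imset_f // !inE ts.
have [adjp _] := bad_dominator mR ptR badp.
have sR : s \in R by rewrite setU11.
have sp : s != pp t by apply: contraNneq pS => <-.
by have := adjp s sR sp; rewrite e_sym (negbTE (bad _ xp pS)).
Qed.

(** * Minimum dominating sets whose cross graph is a tree *)

Section Tight.
Variable S : {set T}.
Hypothesis minS : min_dominating S.
Hypothesis goodS : forall s, s \in S -> exists2 p, p \in nb x :\: S & e s p.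
Hypothesis one_out : forall s p q, s \in S -> p \in nb x :\: S ->
  q \in nb x :\: S -> e s p -> e s q -> p = q.
Hypothesis one_in : forall w s t, w \notin x |: nb x -> s \in S -> t \in S ->
  e s w -> e t w -> s = t.

Let SxW : S \subset nb x /\
  forall w, w \notin x |: nb x -> exists2 s, s \in S & e s w.
Proof. exact/dominatingP/(proj1 minS). Qed.
Let Sx := proj1 SxW.
Let dom := proj2 SxW.

(** The degrees of [x] and [w0] add up to at least 7, and that of [x] is no smaller. *)
Lemma four_le_hub : 4 <= #|nb x|.
Proof.
move: (far_w0); rewrite farE => /andP[w0x xw0]; have [z xz wz] := hub_dom far_w0.
have := @ore x w0 z; rewrite eq_sym => /(_ w0x xw0 xz wz).
by move: (hub_max w0) card_T; clear; lia.
Qed.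

Lemma card_out s : s \in S -> #|nb s :&: (nb x :\: S)| = 1.
Proof.
move=> sS; have [p pP sp] := goodS sS; apply/eqP/cards1P; exists p.
apply/setP => y; rewrite in_setI in_set1 inE; apply/andP/eqP => [[sy yP]|->//].
exact: one_out sy sp.
Qed.

(** The vertices [x], [w] and those of [Z] are adjacent to neither [x] nor [w], which leaves at
    least [size Z + 2] common neighbours; by [one_in] only one of them lies in [S]. *)
Lemma out_neighbour w Z D : w \notin x |: nb x -> uniq (w :: Z) ->
    all (fun y => (y \notin x |: nb x) && ~~ e w y) Z -> size D <= size Z ->
  exists y, [/\ y \in nb x :\: S, e w y & y \notin D].
Proof.
move=> wW uZ aZ DZ; have [s sS sw] := dom wW.
have [|||y [xy wy]] := far_neighbour e_simple ore hub_dom wW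
    (Z := w :: Z) (D := s :: D) => //.
  by rewrite /= wW e_irr.
rewrite in_cons negb_or => /andP[ys yD]; exists y; split=> //.
rewrite in_setD inE xy andbT; apply: contra ys => yS.
by apply/eqP/(one_in wW) => //; rewrite e_sym.
Qed.

(** Adding [p] to the star leaves every vertex of [S] its cross neighbour in N. Outside the star
    everything is connected to a far vertex [w1] missed by [p]: a far vertex not adjacent to [w1]
    has a neighbour in N - S other than [p]. *)
Lemma cist_isolated_outside p : p \in nb x :\: S ->
    (forall s, s \in S -> ~~ e s p) ->
  has_completely_independent_spanning_trees 2 e.
Proof.
move=> pP nSp; move: (pP); rewrite in_setD inE => /andP[pS xp].
set B := ~: (x |: (p |: S)).
have BE v : (v \in B) = [&& v != x, v != p & v \notin S].
  by rewrite in_setC !in_setU1 !negb_or.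
have Sx' : p |: S \subset nb x by rewrite subUset sub1set inE xp.
have farB w : w \notin x |: nb x -> w \in B.
  by move=> wW; rewrite in_setC (far_notin_star Sx' wW).
have PB q : q \in nb x :\: S -> q != p -> q \in B.
  rewrite in_setD inE => /andP[qS xq] qp.
  by rewrite BE (hub_neq e_simple xq) qp.
have px q : q \in nb x :\: S -> e q x by rewrite in_setD inE e_sym => /andP[].
have nx w : w \notin x |: nb x -> ~~ e x w by rewrite farE => /andP[].
have inB y w : e w y -> w \notin x |: nb x -> y != p -> y \notin S -> y \in B.
  move=> wy /nx nxw yp yS; rewrite BE yp yS !andbT.
  by apply: contraTneq wy => ->; rewrite e_sym.
pose c := connect (induced e B).
have csym u v : c u v = c v u by apply: connect_induced_sym.
have [w1 w1W npw1] := no_dom hub_max xp.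
(* Two vertices that are not connected inside B have x and p as their only
   common neighbours, and hence every other vertex is adjacent to one of them. *)
have cover p1 p2 z : p1 \in nb x :\: S -> p2 \in nb x :\: S -> p1 != p -> p2 != p ->
    ~~ c p1 p2 -> z != p1 -> z != p2 -> e p1 z || e p2 z.
  move=> P1 P2 p1p p2p nc z1 z2; apply/negPn/negP; rewrite negb_or => nz.
  have p12 : p1 != p2 by apply: contraNneq nc => ->; apply: connect0.
  have n12 : ~~ e p1 p2 by apply: contra nc => e12; apply: connect_edge; rewrite ?(PB _ P1) ?(PB _ P2).
  have [|||y [p1y p2y]] := common_neighbour ore p12 n12 (px _ P1) (px _ P2)
    (Z := [:: p1; p2; z]) (D := [:: x; p]) => //.
  - by rewrite /= !inE negb_or p12 !(eq_sym _ z) z1 z2.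
  - by rewrite /= !e_irr n12 (e_sym p2) n12 nz.
  rewrite !inE negb_or => /andP[yx yp].
  have [yS|yS] := boolP (y \in S).
    by case/eqP: p12; apply: (one_out yS); rewrite // e_sym.
  case/negP: nc; apply: (connect_path2 e_simple _ _ _ p1y p2y);
    rewrite ?(PB _ P1) ?(PB _ P2) //.
  by rewrite BE yx yp.
have claim p1 p2 : p1 \in nb x :\: S -> p2 \in nb x :\: S -> p1 != p -> p2 != p ->
    e p1 w1 -> c p1 p2.
  move=> P1 P2 p1p p2p e1; apply/negPn/negP => nc.
  have xp1 : e x p1 by rewrite e_sym px.
  have [w2 w2W n2] := no_dom hub_max xp1.
  have farP w q : w \notin x |: nb x -> q \in nb x :\: S -> w != q.
    by move=> wW qP; apply: contraNneq wW => ->; rewrite !inE e_sym px ?orbT.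
  have e22 : e p2 w2.
    by have := cover p1 p2 w2 P1 P2 p1p p2p nc; rewrite (negbTE n2); apply; apply: farP.
  have [[[B1 B2] Bw1] Bw2] := (PB _ P1 p1p, PB _ P2 p2p, farB _ w1W, farB _ w2W).
  have c1 : c p1 w1 by apply: connect_edge.
  have n2w1 : ~~ e p2 w1.
    apply: contra nc => e2; apply: connect_trans c1 _.
    by apply: connect_edge; rewrite // e_sym.
  have w12 : w1 != w2 by apply: contraTneq e1 => ->.
  have n12 : ~~ e w1 w2.
    apply: contra nc => e12; apply: connect_trans c1 _.
    exact: (connect_path2 e_simple _ _ _ e12 e22).
  have [|||p3 [P3 e3 p31]] := out_neighbour w1W (Z := [:: w2]) (D := [:: p1]) => //.
  - by rewrite /= inE w12.
  - by rewrite /= w2W n12.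
  rewrite inE in p31.
  have p3p : p3 != p by apply: contraTneq e3 => ->; rewrite e_sym.
  have nc3 : ~~ c p3 p2.
    apply: contra nc => c3; apply: connect_trans c1 (connect_trans _ c3).
    by apply: connect_edge; rewrite ?(PB _ P3).
  have [s sS sw] := dom w1W.
  have sP q : q \in nb x :\: S -> s != q.
    by rewrite in_setD => /andP[qS _]; apply: contraNneq qS => <-.
  (* By [cover], [s] is adjacent to [p2] or to both [p1] and [p3]; [one_out] excludes the latter.
     Then [p2] and [w1] share [s], and their second common neighbour connects them in [B]. *)
  have e2s : e p2 s.
    have := cover p1 p2 s P1 P2 p1p p2p nc (sP _ P1) (sP _ P2).
    have := cover p3 p2 s P3 P2 p3p p2p nc3 (sP _ P3) (sP _ P2).
    case: (boolP (e p2 s)) => //; rewrite !orbF ![e _ s]e_sym => _ s3 s1.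
    by case/eqP: p31; apply: (one_out sS).
  rewrite e_sym in sw; have p2w1 : p2 != w1 by rewrite eq_sym farP.
  have [y [e2y wy ys]] := second_common_neighbour e_simple ore p2w1 n2w1 e2s sw.
  have yS : y \notin S.
    apply: contra ys => yS; apply/eqP/(one_in w1W) => //; by rewrite e_sym.
  have yp : y != p by apply: contraTneq wy => ->; rewrite e_sym.
  case/negP: nc; apply: connect_trans c1 _; rewrite -/c csym.
  apply: (connect_path2 e_simple _ _ _ e2y wy) => //.
  exact: inB wy w1W yp yS.
have [|||y [yP wy _]] := out_neighbour w1W (Z := [::]) (D := [::]) => //.
have yp : y != p by apply: contraTneq wy => ->; rewrite e_sym.
have cP q : q \in nb x :\: S -> q != p -> c q y.
  by move=> qP qp; rewrite csym; apply: claim; rewrite // e_sym.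
have cw1 : c w1 y := connect_edge (farB _ w1W) (PB _ yP yp) wy.
have [s sS] := min_nonempty minS.
have xs := inhub minS sS.
have sp : p != s by apply: contraNneq pS => ->.
(* As [s] misses at least |S| - 1 far vertices, its degree is at most |W| + 2; so that of the
   nonadjacent [p] is at least |N| - 1. *)
have d3 : 3 <= #|nb p|.
  have d := @ore p s x sp.
  rewrite e_sym nSp // !(e_sym _ x) xp xs in d; have {}d := d isT isT isT.
  have split := degree_split Sx xs; rewrite card_out // in split.
  move: d split (min_missing minS sS) (card_far s) (card_hub e_simple x).
  by move: (card_nb_min sS) four_le_hub; clear; lia.
have [|b1 b1p b1x] := @exists_notin_seq T (nb p) [:: x]; first by apply: leq_trans d3.
have [|b2 b2p b2x] := @exists_notin_seq T (nb p) [:: x; b1]; first by apply: leq_trans d3.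
rewrite !inE ?negb_or in b1p b2p b1x b2x; case/andP: b2x => b2x b21.
have bB b : e p b -> b != x -> b \notin x |: (p |: S).
  move=> pb bx; rewrite !in_setU1 !negb_or bx eq_sym (edge_neq e_simple pb) /=.
  by apply: contraL pb => bS; rewrite e_sym nSp.
apply: (cist_dominating_add e_simple Sx pP).
- apply: (@pivot_connected _ _ e_simple _ y) => v vB.
  have [vW|] := boolP (v \notin x |: nb x); last first.
    move: vB; rewrite BE => /and3P[vx vp vS].
    by rewrite farE vx negbK => xv; apply: cP; rewrite // in_setD inE vS.
  have [->//|vw1] := eqVneq v w1.
  have [evw1|nvw1] := boolP (e v w1).
    exact: connect_trans (connect_edge vB (farB _ w1W) evw1) cw1.
  have [|||q [qP vq]] := out_neighbour vW (Z := [:: w1]) (D := [:: p]) => //.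
  + by rewrite /= inE vw1.
  + by rewrite /= w1W nvw1.
  rewrite inE => qp.
  exact: connect_trans (connect_edge vB (PB _ qP qp) vq) (cP _ qP qp).
- exact: dom.
- move=> t tS; have [q qP tq] := goodS tS; exists q => //.
  move: qP; rewrite !in_setD in_setU1 negb_or => /andP[-> ->]; rewrite !andbT.
  by apply: contraTneq tq => ->; apply: nSp.
- by exists b1, b2; rewrite !bB // eq_sym.
Qed.

(** The edges between [S] and [P] form a perfect matching, so [P] is a minimum dominating set too
    and may replace [S]. If that yields no edge to delete, each far vertex has one neighbour in [S]
    and one in [P], the far vertices form a clique, and degree counting leads to a contradiction. *)
Lemma cist_matched_outside :
    (forall p, p \in nb x :\: S -> exists2 s, s \in S & e s p) ->
  has_completely_independent_spanning_trees 2 e.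
Proof.
move=> matched; pose P := nb x :\: S.
have Px : P \subset nb x := subsetDl _ _.
have domP : dominating P.
  apply/dominatingP; split=> // w wW.
  have [|||y [yP wy _]] := out_neighbour wW (Z := [::]) (D := [::]) => //.
  by exists y; rewrite // e_sym.
have cardP : #|P| = #|S|.
  apply/eqP; rewrite eqn_leq (proj2 minS) // andbT.
  have [g gP] : exists g : T -> T, forall p, p \in P -> g p \in S /\ e (g p) p.
    apply: (@fin_all_exists T (fun _ => T)
      (fun p s => p \in P -> s \in S /\ e s p)) => p.
    have [/matched[s sS sp]|pP] := boolP (p \in P); last by exists p.
    by exists s.
  rewrite -(@card_in_imset _ _ g P); last first.
    move=> p q pP qP E; have [gS gp] := gP p pP; have [_ gq] := gP q qP.
    by apply: (one_out gS) => //; rewrite E.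
  by apply: subset_leq_card; apply/subsetP => _ /imsetP[p /gP[gS _] ->].
have minP : min_dominating P by split=> // S' /(proj2 minS); rewrite cardP.
have PD : nb x :\: P = S.
  by rewrite setDDr setDv set0U; apply/setIidPr.
have goodP p : p \in P -> exists2 s, s \in nb x :\: P & e p s.
  by move=> /matched[s sS sp]; exists s; rewrite ?PD // e_sym.
have domPW := proj2 (dominatingP _ domP).
have [/existsP[w /existsP[p /existsP[q /and4P[wW pP qP /and3P[pw qw pq]]]]]|none] :=
    boolP [exists w, exists p, exists q, [&& w \notin x |: nb x, p \in P, q \in P
      & [&& e p w, e q w & p != q]]].
  apply: (cist_dominating e_simple Px (min_connected minP) domPW goodP).
  by right; exists w, p, q.
have one_inP w p q : w \notin x |: nb x -> p \in P -> q \in P -> e p w -> e q w ->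
    p = q.
  move=> wW pP qP pw qw; apply/eqP; apply: contraNT none => pq.
  apply/existsP; exists w; apply/existsP; exists p; apply/existsP; exists q.
  by rewrite wW pP qP pw qw.
have clique w w' : w \notin x |: nb x -> w' \notin x |: nb x -> w != w' -> e w w'.
  move=> wW w'W ww'; apply/negPn/negP => nww'.
  have [p pP pw] := domPW w wW.
  have [|||y [yP wy]] := out_neighbour wW (Z := [:: w']) (D := [:: p]) => //.
  - by rewrite /= inE ww'.
  - by rewrite /= w'W nww'.
  by rewrite inE => /eqP[]; apply: (one_inP w) => //; rewrite e_sym.
have dw w : w \notin x |: nb x -> #|nb w| <= #|W| + 1.
  move=> wW; have [p pP pw] := domPW w wW; have [s sS sw] := dom wW.
  have sub : nb w \subset [set s; p] :|: (W :\ w).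
    apply/subsetP => y; rewrite inE => wy.
    have yx : y != x.
      by apply: contraTneq wy => ->; rewrite e_sym; move: wW; rewrite farE => /andP[].
    have [xy|xy] := boolP (e x y); last first.
      by rewrite in_setU in_setD1 in_setC farE yx xy eq_sym (edge_neq e_simple wy) orbT.
    rewrite !in_setU !in_set1; have [yS|yS] := boolP (y \in S).
      by rewrite (one_in wW yS sS) ?eqxx // e_sym.
    by rewrite (one_inP w y p) ?eqxx ?orbT // ?[e y w]e_sym // in_setD yS inE.
  have cW : #|W| = 1 + #|W :\ w| by rewrite (cardsD1 w) in_setC wW.
  have le := leq_trans (subset_leq_card sub) (leq_card_setU _ _).
  have c2 : #|[set s; p]| <= 2 by rewrite cards2; case: eqP.
  by move: cW le c2; clear; lia.
have cx : #|nb x| = #|S| + #|S|.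
  by rewrite -(cardsID S (nb x)) (setIidPr Sx) -/P cardP.
have cT := card_hub e_simple x.
(* A far vertex [w] missed by [s] is adjacent to the private vertex [v] of [s]. As [w] has degree at
   most |W| + 1, [s] has degree at least n - |W| - 1 = |N|. *)
have degS s : s \in S -> #|nb s| = #|nb x|.
  move=> sS; apply/eqP; rewrite eqn_leq hub_max /=.
  have [w wW nsw] := no_dom hub_max (inhub minS sS).
  have [v [vW sv _]] := min_private minS sS.
  have wv : w != v by apply: contraNneq nsw => ->.
  have sw : s != w.
    by apply: contraNneq wW => <-; rewrite !inE (inhub minS sS) orbT.
  have := @ore s w v sw nsw sv (clique w v wW vW wv).
  by move: (dw w wW) cT; clear; lia.
have cS s : s \in S -> #|S| + #|S| = 2 + #|nb s :&: S| + #|nb s :&: W|.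
  move=> sS; rewrite -cx -(degS s sS) (degree_split Sx (inhub minS sS)).
  by rewrite card_out //; clear; lia.
(* Both [x] and [w0] have degree at most |N| = 2|S|, with sum at least 1 + |N| + |W|. *)
have W_le : #|W| < #|S| + #|S|.
  move: (far_w0); rewrite farE => /andP[w0x xw0].
  have [z xz wz] := hub_dom far_w0.
  have := @ore x w0 z; rewrite eq_sym => /(_ w0x xw0 xz wz).
  by move: (hub_max w0) cT cx; clear; lia.
have apart s t : s \in S -> t \in S -> s != t ->
    nb t :&: W \subset W :\: (nb s :&: W).
  move=> sS tS st; apply/subsetP => y; rewrite in_setI inE => /andP[ty yW].
  rewrite in_setD yW andbT in_setI yW andbT inE; apply: contra st => sy.
  by apply/eqP/(@one_in y) => //; move: yW; rewrite in_setC.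
have [s sS] := min_nonempty minS.
have [w wW nsw] := no_dom hub_max (inhub minS sS).
have [t tS tw] := dom wW.
have st : s != t by apply: contraNneq nsw => ->.
have [/existsP[r /and3P[rS rs rt]]|two] := boolP
    [exists r, [&& r \in S, r != s & r != t]].
  (* Each member of [S] has at least |S| - 1 far neighbours, and these sets are disjoint. Three
     members give 3(|S| - 1) at most |W|, hence below 2|S|, which fails from |S| = 3 on. *)
  exfalso; rewrite eq_sym in rs; rewrite eq_sym in rt.
  have tsub : nb t :&: W \subset W :\: (nb s :&: W) := apart s t sS tS st.
  have rsub : nb r :&: W \subset (W :\: (nb s :&: W)) :\: (nb t :&: W).
    apply/subsetP => y yr; have := subsetP (apart s r sS rS rs) y yr.
    have := subsetP (apart t r tS rS rt) y yr.
    by rewrite !in_setD => /andP[-> _] /andP[-> ->].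
  have le1 := card_disjoint (subsetIr (nb s) W) (subxx (W :\: (nb s :&: W))).
  have le2 := card_disjoint tsub rsub.
  move: (cS s sS) (cS t tS) (cS r rS) le1 le2 W_le.
  move: (card_nb_min sS) (card_nb_min tS) (card_nb_min rS).
  have c3 : 3 <= #|S|.
    have sub : [set s; t; r] \subset S by rewrite !subUset !sub1set sS tS.
    apply: leq_trans (subset_leq_card sub).
    by rewrite setUC cardsU1 cards2 !inE negb_or !(eq_sym r) st rs rt.
  by move: c3; clear; lia.
have S2 y : y \in S -> (y == s) || (y == t).
  move=> yS; apply: contraNT two; rewrite negb_or => /andP[ys yt].
  by apply/existsP; exists y; rewrite yS ys.
(* If [s] and [t] are adjacent, [t] is adjacent to every vertex that [s] misses, contrary to
   [no_dom] at [s], a vertex of maximum degree. *)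
have [est|nst] := boolP (e s t).
  have sdeg v : #|nb v| <= #|nb s| by rewrite (degS s sS).
  have [v] := no_dom sdeg est; rewrite farE => /andP[vs nsv] /negP[].
  have toS r : r \in S -> e r v -> e t v.
    by move=> /S2/orP[]/eqP-> // sv; rewrite sv in nsv.
  have [vW|] := boolP (v \notin x |: nb x).
    by have [r rS rv] := dom vW; apply: toS rv.
  rewrite farE negb_and !negbK => /orP[/eqP vx|xv].
    by move: nsv; rewrite vx e_sym (inhub minS sS).
  have [/S2|vS] := boolP (v \in S).
    by rewrite (negbTE vs) /= => /eqP vt; rewrite vt est in nsv.
  have [|r rS rv] := matched v; first by rewrite in_setD vS inE.
  exact: toS rv.
(* Now [S] is independent, so [s] and [t] have 2|S| - 2 far neighbours each; the sum 4|S| - 4 is not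
   below 2|S|. *)
exfalso.
have noS r : r \in S -> nb r :&: S = set0.
  move=> rS; apply/setP => y; rewrite !inE; apply/negP => /andP[+ /S2/orP yst].
  have /orP rst := S2 r rS.
  by case: yst rst => /eqP-> [] /eqP->; apply/negP; rewrite ?e_irr // e_sym.
have c2 : 2 <= #|S|.
  have sub : [set s; t] \subset S by rewrite subUset !sub1set sS.
  by apply: leq_trans (subset_leq_card sub); rewrite cards2 st.
have le := card_disjoint (subsetIr (nb s) W) (apart s t sS tS st).
move: (cS s sS) (cS t tS); rewrite !noS // cards0.
by move: le W_le c2 four_le_hub cx; clear; lia.
Qed.
End Tight.

(** A good minimum set either offers an edge to delete or is tight; then some vertex of N - S has no
    neighbour in [S], or all have one. *)
Lemma cist_no_dominator : has_completely_independent_spanning_trees 2 e.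
Proof.
have [S [mS good]] := good_dominating.
have [/dominatingP[Sx dom] _] := mS.
have [/existsP[s /existsP[p /existsP[q /and4P[sS pP qP /and3P[sp sq pq]]]]]|out] :=
    boolP [exists s, exists p, exists q, [&& s \in S, p \in nb x :\: S,
      q \in nb x :\: S & [&& e s p, e s q & p != q]]].
  apply: (cist_dominating e_simple Sx (min_connected mS) dom good).
  by left; exists s, p, q.
have [/existsP[w /existsP[s /existsP[t /and4P[wW sS tS /and3P[sw tw st]]]]]|in_] :=
    boolP [exists w, exists s, exists t, [&& w \notin x |: nb x, s \in S, t \in S
      & [&& e s w, e t w & s != t]]].
  apply: (cist_dominating e_simple Sx (min_connected mS) dom good).
  by right; exists w, s, t.
have one_out s p q : s \in S -> p \in nb x :\: S -> q \in nb x :\: S ->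
    e s p -> e s q -> p = q.
  move=> sS pP qP sp sq; apply/eqP; apply: contraNT out => pq.
  apply/existsP; exists s; apply/existsP; exists p; apply/existsP; exists q.
  by rewrite sS pP qP sp sq.
have one_in w s t : w \notin x |: nb x -> s \in S -> t \in S ->
    e s w -> e t w -> s = t.
  move=> wW sS tS sw tw; apply/eqP; apply: contraNT in_ => st.
  apply/existsP; exists w; apply/existsP; exists s; apply/existsP; exists t.
  by rewrite wW sS tS sw tw.
have [/existsP[p /andP[pP /forallP np]]|all] := boolP
    [exists p, (p \in nb x :\: S) && [forall s, (s \in S) ==> ~~ e s p]].
  apply: (cist_isolated_outside mS good one_out one_in pP) => s sS.
  by have := np s; rewrite sS.
apply: (cist_matched_outside mS good one_out one_in) => p pP.
have /existsPn/(_ p) := all; rewrite pP /= => /forallPn[s].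
by rewrite negb_imply negbK => /andP[sS sp]; exists s.
Qed.
End Centre.
End NoDominator.

Theorem theorem1p7 (T : finType) (e : rel T)
    (he : simple_graph e) (hconn : connected_graph e) (hn : 7 <= #|T|)
    (hmu : le_natbar (Some #|T|) (mu2 e)) :
  has_completely_independent_spanning_trees 2 e.
Proof.
have [e_sym e_irr] := he.
have ore u v z : u != v -> ~~ e u v -> e u z -> e v z ->
    #|T| <= #|[set w | e u w]| + #|[set w | e v w]|.
  move=> uv nuv uz vz.
  have dist : distance e u v == Some 2.
    have walk0 : walk_of_length e u v 0 = false.
      by apply/negbTE/existsPn => p; rewrite tuple0 /= (negbTE uv).
    have walk1 : walk_of_length e u v 1 = false.
      apply/negbTE/existsPn => p; case/tupleP: p => a p; rewrite tuple0 /= andbT.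
      by apply/negP => /andP[ua /eqP av]; rewrite -av ua in nuv.
    have walk2 : walk_of_length e u v 2.
      by apply/existsP; exists [tuple z; v]; rewrite /= uz e_sym vz eqxx.
    (* The order exceeds 2, so the search for the distance includes walks of length 2. *)
    by rewrite /distance; move: hn; case: #|T| => [|[|[|n]]] //= _; rewrite walk0 walk1 walk2.
  have ncpl : complete_graph e = false.
    apply/negbTE/forallPn; exists u; apply/forallPn; exists v.
    by rewrite uv nuv.
  move: hmu; rewrite /mu2 ncpl.
  have in_uv := mem_index_enum (u, v).
  (* By induction on the index list, the minimum is at most the value at the member [(u, v)]. *)
  elim: (index_enum _) in_uv => // a l IH; rewrite inE big_cons.
  case/predU1P => [<-|/IH {}IH].
    rewrite /= dist; case: (\big[_/_]_(_ <- _ | _) _) => [m|] //=.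
    by rewrite leq_min => /andP[].
  case: ifP => _ //; move: IH; case: (\big[_/_]_(_ <- _ | _) _) => [m|] /= IH.
    by rewrite leq_min => /andP[_ /IH].
  by move=> _; apply: IH.
have [x _ xmax] : exists2 x, x \in T & forall v, #|[set w | e v w]| <= #|[set w | e x w]|.
  have [x0 _] : exists x0 : T, x0 \in T by apply/card_gt0P; apply: leq_trans hn.
  by case: (@arg_maxnP T x0 xpredT (fun v => #|[set w | e v w]|)) => // x _ xm; exists x => // v; apply: xm.
(* A dominator is sought at every vertex of maximum degree, since [no_dom] speaks of all of them. *)
have [/existsP[y /existsP[s /and3P[/forallP ymax ys /forallP dom]]]|none] := boolP
    [exists y, exists s, [&& [forall v, #|[set w | e v w]| <= #|[set w | e y w]|],
      e y s & [forall w, (w \notin y |: [set w | e y w]) ==> e s w]]].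
  apply: (cist_one_dominator he ore hn (max_degree_distance he ore hconn ymax)
    ymax ys) => w wW.
  by have := dom w; rewrite wW.
have [/existsP[w0 far_w0]|near] := boolP
    [exists w0, w0 \notin x |: [set w | e x w]]; last first.
  apply: (cist_universal he ore hn (x := x)) => y yx.
  by apply: contraNT near => nxy; apply/existsP; exists y; rewrite farE yx.
apply: (cist_no_dominator he ore hn (max_degree_distance he ore hconn xmax) xmax far_w0).
move=> y s ymax ys.
have /existsPn/(_ y)/existsPn/(_ s) := none.
have -> /= : [forall v, #|[set w | e v w]| <= #|[set w | e y w]|] by apply/forallP.
by rewrite ys /= => /forallPn[w]; rewrite negb_imply => /andP[wW nsw]; exists w.
Qed.
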